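(* Let $a\in(0,1)$ and let $\rho_1,\rho_2,\sigma$ be states with $T(\rho_1,\rho_2)=t$. Then $$|S_a(\rho_1\|\sigma)-S_a(\rho_2\|\sigma)|\le 1-S_a(1-t\|0)-S_a(t\|1)=t-S_a(t\|1).$$ Moreover, equality holds when $\rho_1\perp\sigma$ (i.e. $\mathrm{Tr}\,\rho_1\sigma=0$) and $\rho_2=t\sigma+(1-t)\rho_1$.
   Context: All operators act on a finite-dimensional complex Hilbert space; a state is a positive semidefinite operator of trace one. $T(\rho,\sigma)=\frac12\|\rho-\sigma\|_1=\mathrm{Tr}(\rho-\sigma)_+$ is the trace distance, where $X_+=(X+|X|)/2$. For positive semidefinite $A,B$, the relative entropy is $S(A\|B)=\mathrm{Tr}\,A(\log A-\log B)$ (logarithms taken on supports, $0\log 0=0$, and $S(A\|B)=+\infty$ if the support of $A$ is not contained in that of $B$). For $a\in(0,1)$ the telescopic relative entropy is $S_a(A\|B)=\frac{1}{-\log a}S(A\|aA+(1-a)B)$. For nonnegative scalars $b,c$ this reads $S_a(b\|c)=\frac{b(\log b-\log(ab+(1-a)c))}{-\log a}$ (with $0\log 0=0$); in particular $S_a(b\|0)=b$. *)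

(* Defs.v *)
From Stdlib Require Import Reals Lra ClassicalEpsilon.
Open Scope R_scope.

Record C := mkC { Re : R; Im : R }.
Definition C0 : C := mkC 0 0.
Definition C1 : C := mkC 1 0.
Definition RtoC (r : R) : C := mkC r 0.
Definition Cadd (x y : C) : C := mkC (Re x + Re y) (Im x + Im y).
Definition Copp (x : C) : C := mkC (- Re x) (- Im x).
Definition Cmul (x y : C) : C :=
  mkC (Re x * Re y - Im x * Im y) (Re x * Im y + Im x * Re y).
Definition Cconj (x : C) : C := mkC (Re x) (- Im x).

Fixpoint Csum (n : nat) (f : nat -> C) : C :=
  match n with O => C0 | S m => Cadd (Csum m f) (f m) end.

(** Matrices on C^n: entries with indices < n are meaningful. *)
Definition Mat := nat -> nat -> C.
Definition meq (n : nat) (A B : Mat) : Prop :=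
  forall i j, (i < n)%nat -> (j < n)%nat -> A i j = B i j.
Definition Mmul (n : nat) (A B : Mat) : Mat :=
  fun i j => Csum n (fun k => Cmul (A i k) (B k j)).
Definition Madj (A : Mat) : Mat := fun i j => Cconj (A j i).
Definition Madd (A B : Mat) : Mat := fun i j => Cadd (A i j) (B i j).
Definition Mscale (r : R) (A : Mat) : Mat := fun i j => Cmul (RtoC r) (A i j).
Definition Msub (A B : Mat) : Mat := Madd A (Mscale (-1) B).
Definition Mid : Mat := fun i j => if Nat.eqb i j then C1 else C0.
Definition Mdiag (l : nat -> R) : Mat :=
  fun i j => if Nat.eqb i j then RtoC (l i) else C0.
Definition trace (n : nat) (A : Mat) : C := Csum n (fun i => A i i).

Definition hermitian (n : nat) (A : Mat) : Prop := meq n A (Madj A).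
Definition qform (n : nat) (A : Mat) (v : nat -> C) : C :=
  Csum n (fun i => Csum n (fun j => Cmul (Cconj (v i)) (Cmul (A i j) (v j)))).
Definition psd (n : nat) (A : Mat) : Prop :=
  hermitian n A /\ forall v : nat -> C, 0 <= Re (qform n A v).
Definition state (n : nat) (rho : Mat) : Prop := psd n rho /\ trace n rho = C1.

Definition unitary (n : nat) (U : Mat) : Prop := meq n (Mmul n (Madj U) U) Mid.
Definition eigdecomp (n : nat) (A U : Mat) (l : nat -> R) : Prop :=
  unitary n U /\ meq n A (Mmul n (Mmul n U (Mdiag l)) (Madj U)).

(** a chosen spectral decomposition (exists for Hermitian A) *)
Definition spec (n : nat) (A : Mat) : Mat * (nat -> R) :=
  epsilon (inhabits (Mid, fun _ : nat => 0))
          (fun p => eigdecomp n A (fst p) (snd p)).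

Definition fcalc (n : nat) (f : R -> R) (A : Mat) : Mat :=
  let p := spec n A in
  Mmul n (Mmul n (fst p) (Mdiag (fun i => f (snd p i)))) (Madj (fst p)).

Definition Mabs (n : nat) (X : Mat) : Mat := fcalc n Rabs X.
Definition Mpos (n : nat) (X : Mat) : Mat := Mscale (1/2) (Madd X (Mabs n X)).
Definition tdist (n : nat) (rho sigma : Mat) : R :=
  Re (trace n (Mpos n (Msub rho sigma))).

(** logarithm taken on the support: Stdlib's [ln] is 0 on nonpositive reals,
    so eigenvalue 0 is mapped to 0. *)
Definition Mlog (n : nat) (A : Mat) : Mat := fcalc n ln A.

Definition supp_proj (n : nat) (A : Mat) : Mat :=
  fcalc n (fun x => if Req_dec_T x 0 then 0 else 1) A.
Definition supp_incl (n : nat) (A B : Mat) : Prop :=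
  meq n (Mmul n (supp_proj n B) (supp_proj n A)) (supp_proj n A).

Inductive ereal := Fin (r : R) | PInf.

Definition relent (n : nat) (A B : Mat) : ereal :=
  if excluded_middle_informative (supp_incl n A B)
  then Fin (Re (trace n (Mmul n A (Msub (Mlog n A) (Mlog n B)))))
  else PInf.

Definition Sa (n : nat) (a : R) (A B : Mat) : ereal :=
  match relent n A (Madd (Mscale a A) (Mscale (1 - a) B)) with
  | Fin r => Fin (r / (- ln a))
  | PInf => PInf
  end.

(** scalar version S_a(b||c), with 0 log 0 = 0 (Stdlib: ln 0 = 0) *)
Definition Sa_sc (a b c : R) : R :=
  b * (ln b - ln (a * b + (1 - a) * c)) / (- ln a).

(* Main.v *)
(* Put S := ((1 - a) / a) sigma, c := Tr S, and
     k(A) := Tr A (log (A + S) - log A),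
   so that S_a(rho || sigma) = 1 - k(rho) / (- ln a); the claim is
   |k(rho1) - k(rho2)| <= t ln (1 + c / t).  It follows from the layer-cake formula
     k(A) = int_0^oo min(A, l S) dl / (l (1 + l)^2),
     min(A, l S) := l c - Tr (l S - A)_+
   (a form of Frenkel's integral formula for the relative entropy), because the
   positive part has a subadditive trace, so that the integrands for rho1 and
   rho2 differ by at most min(t, l c), and
   int_0^oo min(t, l c) dl / (l (1 + l)^2) = t ln (1 + c / t).

   For the formula, replace A by A + x: k is the value at x = 0 of a function Phi
   with Phi' (x) = sum_i mt (nu_i (x)), where mt v = ln (1 + v) - v / (1 + v) and
   the nu_i (x) are the eigenvalues of the pencil (S, A + x).  By Sylvester's law
   of inertia the number of nu_i (x) above th is the number of eigenvalues of
   S / th - A above x, and integrating this count over x gives Tr (S / th - A)_+.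
   Here l = 1 / th, the integral over th is replaced by sums over a grid and the
   one over x by increments with a quadratic error, so no integration theory is
   used. *)

From Stdlib Require Import Reals ClassicalEpsilon.
From mathcomp Require Import all_boot all_order all_algebra.
From mathcomp Require Import complex.
From mathcomp Require Import reals Rstruct.
From mathcomp Require Import ring lra.
Require Import Defs.

Set Implicit Arguments.
Unset Strict Implicit.
Unset Printing Implicit Defensive.

Import Order.TTheory GRing.Theory Num.Theory.
Local Open Scope ring_scope.
Local Open Scope sesquilinear_scope.
Local Open Scope complex_scope.

(** * Spectral decompositions and traces *)

Section Hermitian.
Variable R : rcfType.
Local Notation C := R[i].

Definition sqn (z : C) : R := complex.Re (z * z^*).

Lemma sqnE z : (sqn z)%:C = z * z^*.
Proof. by rewrite /sqn; case: z => a b /=; simpc; congr (_ +i* _); ring. Qed.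

Lemma sqn_ge0 z : 0 <= sqn z.
Proof. by rewrite -ler0c sqnE mulcJ_ge0. Qed.

Lemma sqn_eq0 z : (sqn z == 0) = (z == 0).
Proof.
rewrite -(inj_eq (@complexI R)) sqnE mulf_eq0 conjc_eq0 orbb //.
Qed.

Lemma Re_sum (I : Type) (r : seq I) (P : pred I) (F : I -> C) :
  complex.Re (\sum_(i <- r | P i) F i) = \sum_(i <- r | P i) complex.Re (F i).
Proof. exact: (raddf_sum (@complex.Re R : Rcomplex R -> R)). Qed.

Lemma Re_scale (a : R) (z : C) : complex.Re (a%:C * z) = a * complex.Re z.
Proof. by case: z => x y; simpc. Qed.

Lemma adjM m n p (A : 'M[C]_(m, n)) (B : 'M_(n, p)) :
  (A *m B)^t* = B^t* *m A^t*.
Proof. by rewrite trmx_mul map_mxM. Qed.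

Lemma adjmxE m n (A : 'M[C]_(m, n)) i j : (A^t*) i j = (A j i)^*.
Proof. by rewrite !mxE. Qed.

Definition dg n (l : 'I_n -> R) : 'M[C]_n := diag_mx (\row_i (l i)%:C).

Lemma dgE n (l : 'I_n -> R) i j : dg l i j = (l i)%:C *+ (i == j).
Proof. by rewrite !mxE; case: eqP => [->|]. Qed.

Lemma adj_dg n (l : 'I_n -> R) : (dg l)^t* = dg l.
Proof.
apply/matrixP => i j; rewrite adjmxE !dgE eq_sym; case: eqP => [->|_].
  exact: conjc_real.
exact: conjc0.
Qed.

Lemma dgM n (l m : 'I_n -> R) : dg l *m dg m = dg (fun i => l i * m i).
Proof.
rewrite /dg mulmx_diag; congr diag_mx; apply/rowP => j.
by rewrite !mxE rmorphM.
Qed.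

Lemma eq_dg n (l m : 'I_n -> R) : l =1 m -> dg l = dg m.
Proof. by move=> e; congr diag_mx; apply/rowP => j; rewrite !mxE e. Qed.

Lemma dg1 n : dg (fun _ : 'I_n => 1) = 1%:M.
Proof. by apply/matrixP => i j; rewrite dgE !mxE. Qed.

Lemma dgD n (l m : 'I_n -> R) : dg l + dg m = dg (fun i => l i + m i).
Proof. by apply/matrixP => i j; rewrite mxE !dgE rmorphD mulrnDl. Qed.

Lemma dgZ n a (l : 'I_n -> R) : a%:C *: dg l = dg (fun i => a * l i).
Proof. by apply/matrixP => i j; rewrite mxE !dgE rmorphM mulrnAr. Qed.

Lemma det_dg n (l : 'I_n -> R) : \det (dg l) = (\prod_i l i)%:C.
Proof.
by rewrite det_diag rmorph_prod; apply: eq_bigr => i _; rewrite mxE.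
Qed.

Lemma mul_dgE m n (A : 'M[C]_(m, n)) l i j : (A *m dg l) i j = A i j * (l j)%:C.
Proof. by rewrite mul_mx_diag !mxE. Qed.

(** A relation rather than a chosen decomposition: the same matrix occurs below with bases that come
    from shifts, scalings or a second matrix. *)
Definition eigd n (A U : 'M[C]_n) (l : 'I_n -> R) : Prop :=
  U^t* *m U = 1%:M /\ A = U *m dg l *m U^t*.

Lemma unitary_adjr n (U : 'M[C]_n) : U^t* *m U = 1%:M -> U *m U^t* = 1%:M.
Proof. exact: mulmx1C. Qed.

Lemma eigd_herm n (A U : 'M[C]_n) l : eigd A U l -> A^t* = A.
Proof. by case=> _ ->; rewrite !adjM trmxCK adj_dg mulmxA. Qed.

Lemma herm_eigd n (A : 'M[C]_n) : A^t* = A -> exists U l, eigd A U l.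
Proof.
move=> hA.
have hH : A \is hermsymmx by apply/is_hermitianmxP; rewrite expr0 scale1r hA.
have /orthomx_spectralP := hermitian_normalmx hH.
have := unitarymxP (spectral_unitarymx A).
have := hermitian_spectral_diag_real hH.
have := spectral_unitarymx A.
move: (spectralmx A) (spectral_diag A) => P d hu /mxOverP hr hP e.
(* The spectral theorem gives A as P^-1 D P, so the eigenvectors are the columns of the adjoint of
   P. *)
exists (P^t*), (fun i => complex.Re (d 0 i)); rewrite /eigd trmxCK.
split; first exact: hP.
rewrite e (invmx_unitary hu) /dg; congr (_ *m diag_mx _ *m _).
by apply/rowP => i; rewrite mxE RRe_real.
Qed.

Definition rtr n (A : 'M[C]_n) : R := complex.Re (\tr A).

Lemma rtrD n (A B : 'M[C]_n) : rtr (A + B) = rtr A + rtr B.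
Proof. by rewrite /rtr mxtraceD; case: (\tr A) (\tr B) => a b []. Qed.

Lemma rtrZ n a (A : 'M[C]_n) : rtr (a%:C *: A) = a * rtr A.
Proof. by rewrite /rtr mxtraceZ Re_scale. Qed.

Lemma rtrC n (A B : 'M[C]_n) : rtr (A *m B) = rtr (B *m A).
Proof. by rewrite /rtr mxtrace_mulC. Qed.

Lemma rtr_dg n (l : 'I_n -> R) : rtr (dg l) = \sum_i l i.
Proof.
by rewrite /rtr /mxtrace Re_sum; apply: eq_bigr => i _; rewrite dgE eqxx.
Qed.

(* A doubly stochastic array: it reduces traces of products to real sums. *)
Definition ov n (U W : 'M[C]_n) i j : R := sqn ((U^t* *m W) i j).

Lemma ov_ge0 n (U W : 'M[C]_n) i j : 0 <= ov U W i j.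
Proof. exact: sqn_ge0. Qed.

Lemma ov_suml n (U W : 'M[C]_n) j :
  U^t* *m U = 1%:M -> W^t* *m W = 1%:M -> \sum_i ov U W i j = 1.
Proof.
move=> hU hW; have hU' := unitary_adjr hU; apply: (@complexI R).
rewrite rmorph_sum /=.
transitivity (((U^t* *m W)^t* *m (U^t* *m W)) j j).
  by rewrite [RHS]mxE; apply: eq_bigr => i _; rewrite sqnE adjmxE mulrC.
by rewrite adjM trmxCK mulmxA -(mulmxA _ U) hU' mulmx1 hW mxE eqxx.
Qed.

Lemma ov_sumr n (U W : 'M[C]_n) i :
  U^t* *m U = 1%:M -> W^t* *m W = 1%:M -> \sum_j ov U W i j = 1.
Proof.
move=> hU hW; have hW' := unitary_adjr hW; apply: (@complexI R).
rewrite rmorph_sum /=.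
transitivity (((U^t* *m W) *m (U^t* *m W)^t*) i i).
  by rewrite [RHS]mxE; apply: eq_bigr => j _; rewrite sqnE adjmxE.
by rewrite adjM trmxCK mulmxA -(mulmxA _ W) hW' mulmx1 hU mxE eqxx.
Qed.

(** With K the adjoint of U times W, cyclicity gives the trace of [dg f] K [dg g] K^*, whose terms
    carry the squared moduli of the entries of K. *)
Lemma rtr_ov n (U W : 'M[C]_n) f g :
  rtr ((U *m dg f *m U^t*) *m (W *m dg g *m W^t*)) =
  \sum_i \sum_j f i * g j * ov U W i j.
Proof.
have -> : (U *m dg f *m U^t*) *m (W *m dg g *m W^t*) =
   U *m (dg f *m (U^t* *m W) *m dg g *m W^t*) by rewrite !mulmxA.
rewrite rtrC.
have -> : dg f *m (U^t* *m W) *m dg g *m W^t* *m U =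
          (dg f *m (U^t* *m W) *m dg g) *m (U^t* *m W)^t*.
  by rewrite adjM trmxCK !mulmxA.
rewrite /rtr /mxtrace Re_sum; apply: eq_bigr => i _.
rewrite mxE Re_sum; apply: eq_bigr => j _.
rewrite mul_dgE /dg mul_diag_mx adjmxE 2!mxE /ov /sqn.
move: ((U^t* *m W) i j) => z.
have -> : (f i)%:C * z * (g j)%:C * z^* = (f i * g j)%:C * (z * z^*).
  by rewrite rmorphM; ring.
by rewrite Re_scale.
Qed.

Lemma rtr_eigd n (A U : 'M[C]_n) l : eigd A U l -> rtr A = \sum_i l i.
Proof. by case=> hU ->; rewrite rtrC mulmxA hU mul1mx rtr_dg. Qed.

(** The second factor is the projector on the j-th column of V, so both sides are the j-th diagonal
    entry of A in the basis V. *)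
Lemma rtr_delta n (A U V : 'M[C]_n) a j : eigd A U a ->
  rtr (A *m (V *m dg (fun i => (i == j)%:R) *m V^t*)) = \sum_i a i * ov U V i j.
Proof.
case=> _ ->; rewrite rtr_ov; apply: eq_bigr => i _.
rewrite (bigD1 j) //= eqxx mulr1 big1 ?addr0 // => k /negbTE ->.
by rewrite mulr0 mul0r.
Qed.

Lemma ov_self n (V : 'M[C]_n) i j : V^t* *m V = 1%:M -> ov V V i j = (i == j)%:R.
Proof.
move=> hV; rewrite /ov hV mxE; case: (i == j) => /=.
  by rewrite mulr1n /sqn /=; ring.
by rewrite mulr0n /sqn mul0r.
Qed.

(** Diagonal entries in the eigenbasis of A + B: an eigenvalue of the sum is an average of
    eigenvalues of A plus an average of eigenvalues of B. *)
Lemma eigd_add n (A B U W V : 'M[C]_n) a b y :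
  eigd A U a -> eigd B W b -> eigd (A + B) V y -> forall j,
  y j = \sum_i a i * ov U V i j + \sum_i b i * ov W V i j.
Proof.
move=> hA hB hY j.
have := rtrD (A *m (V *m dg (fun i => (i == j)%:R) *m V^t*))
             (B *m (V *m dg (fun i => (i == j)%:R) *m V^t*)).
rewrite -mulmxDl (rtr_delta V j hA) (rtr_delta V j hB) (rtr_delta V j hY) => <-.
rewrite (bigD1 j) //= ov_self ?hY.1 // eqxx mulr1 big1 ?addr0 // => i /negbTE hi.
by rewrite ov_self ?hY.1 // hi mulr0.
Qed.

Lemma ov_sum_total n (U V : 'M[C]_n) a : U^t* *m U = 1%:M -> V^t* *m V = 1%:M ->
  \sum_j \sum_i a i * ov U V i j = \sum_i a i.
Proof.
move=> hU hV; rewrite exchange_big; apply: eq_bigr => i _.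
by rewrite -mulr_sumr ov_sumr // mulr1.
Qed.

Definition ppart (x : R) := Num.max x 0.

Lemma ppart_le x u : x <= u -> 0 <= u -> ppart x <= u.
Proof. by move=> h1 h2; rewrite /ppart ge_max h1. Qed.

(** Subadditivity of Tr X_+. By [eigd_add] and convexity, the positive part of each eigenvalue of A
    + B is at most the averaged positive parts; summing over j removes the weights, which are doubly
    stochastic. *)
Lemma pos_trace_add n (A B U W V : 'M[C]_n) a b y :
  eigd A U a -> eigd B W b -> eigd (A + B) V y ->
  \sum_j ppart (y j) <= \sum_i ppart (a i) + \sum_i ppart (b i).
Proof.
move=> hA hB hY.
rewrite -(ov_sum_total (fun i => ppart (a i)) hA.1 hY.1).
rewrite -(ov_sum_total (fun i => ppart (b i)) hB.1 hY.1) -big_split /=.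
apply: ler_sum => j _; rewrite (eigd_add hA hB hY).
have le k (c : 'I_n -> R) (p : 'I_n -> R) : (forall i, 0 <= p i) ->
    k = \sum_i c i * p i -> k <= \sum_i ppart (c i) * p i /\ 0 <= \sum_i ppart (c i) * p i.
  move=> hp ->; split; last by apply: sumr_ge0 => i _; rewrite mulr_ge0 ?le_max ?lexx ?orbT.
  by apply: ler_sum => i _; rewrite ler_wpM2r // le_max lexx.
have [h1 h2] := le _ a (ov U V ^~ j) (fun i => ov_ge0 U V i j) erefl.
have [h3 h4] := le _ b (ov W V ^~ j) (fun i => ov_ge0 W V i j) erefl.
exact: ppart_le (lerD h1 h3) (addr_ge0 h2 h4).
Qed.

End Hermitian.

(** * Pencils and inertia *)

Section Pencil.
Variable R : rcfType.
Local Notation C := R[i].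

Lemma eigd_shift n (A U : 'M[C]_n) l x : eigd A U l ->
  eigd (A + x%:C%:M) U (fun i => l i + x).
Proof.
case=> hU ->; split => //.
have -> : x%:C%:M = U *m dg (fun _ => x) *m U^t* :> 'M[C]_n.
  have -> : dg (fun _ => x) = x%:C%:M :> 'M[C]_n.
    by apply/matrixP => i j; rewrite dgE !mxE.
  by rewrite scalar_mxC -mulmxA unitary_adjr // mulmx1.
by rewrite -mulmxDl -mulmxDr dgD.
Qed.

Lemma eigd_scale n (A U : 'M[C]_n) l x : eigd A U l ->
  eigd (x%:C *: A) U (fun i => x * l i).
Proof. by case=> hU ->; split => //; rewrite -dgZ -scalemxAr -scalemxAl. Qed.

Lemma eigd_funM n (A U : 'M[C]_n) l g : U^t* *m U = 1%:M ->
  A = U *m dg l *m U^t* -> A *m (U *m dg g *m U^t*) = U *m dg (fun i => l i * g i) *m U^t*.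
Proof. by move=> hU ->; rewrite !mulmxA -(mulmxA _ _ U) hU mulmx1 -(mulmxA U) dgM. Qed.

(* The number of positive eigenvalues does not grow under congruence: a vector
   supported on the positive indices of [m] cannot be mapped by [K] to one that
   vanishes on the positive indices of [e]. *)
Lemma inertia_le n (K : 'M[C]_n) (e m : 'I_n -> R) :
  K^t* *m dg e *m K = dg m ->
  (#|[pred i | (0 < m i)%R]| <= #|[pred i | (0 < e i)%R]|)%N.
Proof.
move=> hK; rewrite leqNgt; apply/negP => hlt.
set P := [pred i | 0 < m i] in hlt *; set E := [pred i | 0 < e i] in hlt *.
pose T : 'M[C]_(#|P|, #|E|) := \matrix_(i, j) K (enum_val j) (enum_val i).
have hker : kermx T != 0.
  rewrite -mxrank_eq0 mxrank_ker -lt0n subn_gt0.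
  exact: leq_ltn_trans (rank_leq_col T) hlt.
have [i0 hi0] : exists i, row i (kermx T) != 0.
  apply/existsP; apply: contraR hker; rewrite negb_exists => /forallP h.
  by apply/eqP/row_matrixP => i; rewrite row0; apply/eqP; move: (h i); rewrite negbK.
set v := row i0 (kermx T) in hi0.
have hvT : v *m T = 0 by apply/sub_kermxP; exact: row_sub.
pose w : 'cV[C]_n := \col_k \sum_(i < #|P| | enum_val i == k) v 0 i.
have wE i : w (enum_val i) 0 = v 0 i.
  rewrite mxE (bigD1 i) //= big1 ?addr0 // => j /andP[/eqP/enum_val_inj -> ].
  by rewrite eqxx.
have w0 k : ~~ P k -> w k 0 = 0.
  move=> hk; rewrite mxE big1 // => i /eqP hi; case/negP: hk.
  by rewrite -hi; have := enum_valP i; rewrite !inE.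
have hwK j : j \in E -> (K *m w) j 0 = 0.
  move=> hj; rewrite mxE.
  transitivity ((v *m T) 0 (enum_rank_in hj j)); last by rewrite hvT mxE.
  rewrite [RHS]mxE (bigID P) /= [X in _ + X]big1 ?addr0; last first.
    by move=> k hk; rewrite w0 ?mulr0.
  rewrite (big_enum_val (A := P) (fun k => K j k * w k 0)).
  by apply: eq_bigr => i _; rewrite wE [T _ _]mxE enum_rankK_in // mulrC.
have q (l : 'I_n -> R) (z : 'cV[C]_n) :
    (z^t* *m dg l *m z) 0 0 = (\sum_i l i * sqn (z i 0))%:C.
  rewrite mxE rmorph_sum; apply: eq_bigr => i _.
  rewrite mul_dgE adjmxE rmorphM /= sqnE; ring.
have eq0 : \sum_i e i * sqn ((K *m w) i 0) = \sum_i m i * sqn (w i 0).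
  by apply: (@complexI R); rewrite -!q adjM -hK !mulmxA.
have le0 : \sum_i e i * sqn ((K *m w) i 0) <= 0.
  apply: sumr_le0 => j _; case: (ltP 0 (e j)) => hj.
    by rewrite hwK ?inE // /sqn mul0r mulr0.
  by rewrite mulr_le0_ge0 // sqn_ge0.
have [i1 hi1] : exists i, v 0 i != 0.
  apply/existsP; apply: contraR hi0; rewrite negb_exists => /forallP h.
  by apply/eqP/rowP => i; rewrite [RHS]mxE; apply/eqP; move: (h i); rewrite negbK.
have term_ge0 i : 0 <= m i * sqn (w i 0).
  case: (boolP (P i)) => hi; first by rewrite mulr_ge0 ?sqn_ge0 // ltW.
  by rewrite w0 // /sqn mul0r mulr0.
have gt0 : 0 < \sum_i m i * sqn (w i 0).
  rewrite (bigD1 (enum_val i1)) //= ltr_pwDl //; last by apply: sumr_ge0 => i _.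
  rewrite wE mulr_gt0 //; first by have := enum_valP i1; rewrite !inE.
  by rewrite lt_def sqn_ge0 sqn_eq0 hi1.
by move: gt0; rewrite -eq0 ltNge le0.
Qed.

(** Congruence by K, the adjoint of F times G, and by its inverse gives the two inequalities. *)
Lemma inertia n (G F : 'M[C]_n) (e m : 'I_n -> R) : F^t* *m F = 1%:M -> G \in unitmx ->
  G^t* *m (F *m dg e *m F^t*) *m G = dg m ->
  #|[pred i | 0 < m i]| = #|[pred i | 0 < e i]|.
Proof.
move=> hF hG h; set K := F^t* *m G.
have hK : K^t* *m dg e *m K = dg m.
  by rewrite -h /K adjM trmxCK !mulmxA.
pose L := invmx G *m F.
have KL : K *m L = 1%:M by rewrite /K /L mulmxA mulmxK.
clearbody K L.
apply/eqP; rewrite eqn_leq (inertia_le hK) /=.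
apply: (@inertia_le _ L); rewrite -hK.
have LK' : L^t* *m K^t* = 1%:M by rewrite -adjM KL trmx1 map_mx1.
by rewrite !mulmxA LK' mul1mx -mulmxA KL mulmx1.
Qed.

(** A and S are reduced together: some G turns A into the identity and S into [dg nu] by congruence,
    hence Y into [dg (1 + nu)]. Determinants give the product, the trace of S Y^-1 gives the sum,
    and S / th - A is congruent to the diagonal matrix of nu / th - 1, which gives the count. *)
Lemma pencil n (A S Y U W V : 'M[C]_n) a s y (d : R) :
  eigd A U a -> eigd S W s -> eigd Y V y -> Y = A + S ->
  0 < d -> (forall i, d <= a i) -> (forall i, 0 <= s i) -> (forall i, 0 < y i) ->
  exists nu : 'I_n -> R, [/\
    forall i, 0 <= nu i <= (\sum_k s k) / d,
    \prod_j y j = \prod_i a i * \prod_i (1 + nu i),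
    \sum_j (\sum_k s k * ov W V k j) / y j = \sum_i nu i / (1 + nu i)
  & forall th F e, 0 < th -> eigd (th^-1%:C *: S - A) F e ->
    #|[pred i | th < nu i]| = #|[pred i | 0 < e i]| ].
Proof.
move=> hA hS hY eY d0 ha hs hy.
have a0 i : 0 < a i by apply: lt_le_trans (ha i).
(* [G0] is U times a^(-1/2), which normalises A; the unitary [Q] then diagonalises the transformed S
   without disturbing the identity. *)
pose r i := (Num.sqrt (a i))^-1.
have hr i : r i * a i * r i = 1.
  rewrite /r -{2}(sqr_sqrtr (ltW (a0 i))); field.
  by rewrite sqrtr_eq0 -ltNge.
pose G0 := U *m dg r.
have hU := hA.1; have hU' := unitary_adjr hU.
have G0A : G0^t* *m A *m G0 = 1%:M.
  rewrite /G0 adjM adj_dg hA.2 !mulmxA -(mulmxA _ (U^t*) U) hU mulmx1.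
  rewrite -(mulmxA _ (U^t*) U) hU mulmx1 !dgM -dg1.
  by apply: eq_dg => i; exact: hr.
clearbody G0; clear r hr.
have hH : (G0^t* *m S *m G0)^t* = G0^t* *m S *m G0.
  by rewrite adjM adjM trmxCK (eigd_herm hS) mulmxA.
have [Q [nu hQ]] := herm_eigd hH.
have hQQ := hQ.1.
pose G := G0 *m Q.
have GA : G^t* *m A *m G = 1%:M.
  by rewrite /G adjM -!mulmxA (mulmxA A) (mulmxA (G0^t*)) (mulmxA (G0^t*)) G0A mul1mx.
have GS : G^t* *m S *m G = dg nu.
  rewrite /G adjM -!mulmxA (mulmxA S) (mulmxA (G0^t*)) (mulmxA (G0^t*)) hQ.2.
  by rewrite !mulmxA hQQ mul1mx -mulmxA hQQ mulmx1.
clearbody G.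
have GY : G^t* *m Y *m G = dg (fun i => 1 + nu i).
  by rewrite eY mulmxDr mulmxDl GA GS -dg1 dgD.
have uG : G \in unitmx by have := mulmx1_unit GA => -[_].
have uG' : G^t* \in unitmx.
  by move: GA; rewrite -mulmxA => /mulmx1_unit[].
have [hW hWs] := hS.
have nuE i : nu i = \sum_k s k * sqn ((W^t* *m G) k i).
  apply: (@complexI R); rewrite rmorph_sum /=.
  have -> : (nu i)%:C = (dg nu) i i by rewrite dgE eqxx.
  rewrite -GS hWs.
  have -> : G^t* *m (W *m dg s *m W^t*) *m G = (W^t* *m G)^t* *m dg s *m (W^t* *m G).
    by rewrite adjM trmxCK !mulmxA.
  rewrite mxE; apply: eq_bigr => k _; rewrite mul_dgE adjmxE rmorphM /= sqnE; ring.
have nu0 i : 0 <= nu i.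
  by rewrite nuE; apply: sumr_ge0 => k _; rewrite mulr_ge0 ?sqn_ge0.
(* G^* A G = 1 makes G G^* the inverse of A. *)
have ginv : G *m G^t* = U *m dg (fun i => (a i)^-1) *m U^t*.
  have e1 : A *m (G *m G^t*) = 1%:M.
    apply: (can_inj (mulKmx uG')); rewrite mulmx1 !mulmxA GA mul1mx //.
  have e2 : A *m (U *m dg (fun i => (a i)^-1) *m U^t*) = 1%:M.
    rewrite (eigd_funM _ hU hA.2) (@eq_dg _ _ _ (fun=> 1)) ?dg1 ?mulmx1 //.
    by move=> i; rewrite divff // gt_eqF.
  by rewrite -[LHS]mul1mx -(mulmx1C e2) -(mulmxA _ A) e1 mulmx1.
exists nu; split.
- move=> i; rewrite nu0 nuE mulr_suml; apply: ler_sum => k _.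
  rewrite ler_wpM2l //.
  (* One squared entry is at most its row sum, which is a diagonal entry of A^-1 in the eigenbasis
     of S: an average of the 1 / a_j, hence at most 1 / d. *)
  apply: (@le_trans _ _ (\sum_j sqn ((W^t* *m G) k j))).
    by rewrite (bigD1 i) //= lerDl; apply: sumr_ge0 => j _; exact: sqn_ge0.
  have -> : \sum_j sqn ((W^t* *m G) k j) = \sum_j (a j)^-1 * ov U W j k.
    apply: (@complexI R); rewrite !rmorph_sum /=.
    transitivity (((W^t* *m G) *m (W^t* *m G)^t*) k k).
      by rewrite mxE; apply: eq_bigr => j _; rewrite adjmxE sqnE.
    have -> : (W^t* *m G) *m (W^t* *m G)^t* =
       (U^t* *m W)^t* *m dg (fun i => (a i)^-1) *m (U^t* *m W).
      by rewrite !adjM !trmxCK !mulmxA -(mulmxA _ G) ginv !mulmxA.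
    rewrite mxE; apply: eq_bigr => j _; rewrite mul_dgE adjmxE rmorphM /= sqnE; ring.
  rewrite -[leRHS]mulr1 -(ov_suml k hU hW) mulr_sumr.
  apply: ler_sum => j _; rewrite ler_wpM2r ?ov_ge0 // lef_pV2 ?posrE //.
- have detU (B X : 'M[C]_n) l : eigd B X l -> \det B = (\prod_i l i)%:C.
    case=> hX ->; rewrite !det_mulmx mulrC mulrA -det_mulmx hX det1 mul1r.
    exact: det_dg.
  have e1 := congr1 determinant GA; have e2 := congr1 determinant GY.
  rewrite !det_mulmx (detU _ _ _ hA) det1 in e1.
  rewrite !det_mulmx (detU _ _ _ hY) det_dg in e2.
  apply: (@complexI R); rewrite rmorphM /= -e2 -[LHS]mul1r -e1; ring.
- transitivity (rtr (S *m (V *m dg (fun j => (y j)^-1) *m V^t*))).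
    rewrite hWs rtr_ov exchange_big; apply: eq_bigr => j _ /=.
    by rewrite mulr_suml; apply: eq_bigr => k _; ring.
  (* Both matrices are inverse to Y. *)
  have -> : V *m dg (fun j => (y j)^-1) *m V^t* = G *m dg (fun i => (1 + nu i)^-1) *m G^t*.
    have e1 : Y *m (V *m dg (fun i => (y i)^-1) *m V^t*) = 1%:M.
      rewrite (eigd_funM _ hY.1 hY.2) (@eq_dg _ _ _ (fun=> 1)) ?dg1 ?mulmx1 ?unitary_adjr ?hY.1 //.
      by move=> i; rewrite divff // gt_eqF.
    have e2 : Y *m (G *m dg (fun i => (1 + nu i)^-1) *m G^t*) = 1%:M.
      apply: (can_inj (mulKmx uG')); rewrite mulmx1 !mulmxA GY dgM.
      rewrite (@eq_dg _ _ _ (fun=> 1)) ?dg1 ?mul1mx // => i.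
      by rewrite divff // gt_eqF // ltr_pwDl.
    by rewrite -[LHS]mulmx1 -e2 mulmxA (mulmx1C e1) mul1mx.
  rewrite !mulmxA rtrC !mulmxA GS dgM rtr_dg; apply: eq_bigr => i _; ring.
- move=> th F e th0 he.
  have eq : G^t* *m (F *m dg e *m F^t*) *m G = dg (fun i => th^-1 * nu i - 1).
    rewrite -he.2 mulmxBr mulmxBl GA -scalemxAr -scalemxAl GS dgZ -dg1.
    by apply/matrixP => i j; rewrite !mxE; case: eqP => _; rewrite /= ?subr0 // !mulr1n rmorphB.
  rewrite -(inertia he.1 uG eq); apply: eq_card => i; rewrite !inE.
  by rewrite subr_gt0 mulrC ltr_pdivlMr // mul1r.
Qed.

End Pencil.

Local Notation R := Rdefinitions.R.
(* Stdlib binds [R_scope] to the type [R]; from here on terms of type [R] are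
   read in [ring_scope], where [+], [*], [<=] are those of the [realType] [R]. *)
Bind Scope ring_scope with Rdefinitions.R.
Local Arguments ln x%_ring_scope.

(** * The logarithm and layers *)

Lemma lnM_gt0 (x y : R) : 0 < x -> 0 < y -> ln (x * y) = ln x + ln y.
Proof. by move=> /RltP hx /RltP hy; exact: ln_mult. Qed.

Lemma ln_le_subr1 (x : R) : 0 < x -> ln x <= x - 1.
Proof.
move=> hx; rewrite lerBrDl -[leRHS](exp_ln x (elimT RltP hx)).
by apply/RleP; exact: exp_ineq1_le.
Qed.

Lemma ln1 : ln (1 : R) = 0.
Proof. exact: ln_1. Qed.

Lemma lnV_gt0 (x : R) : 0 < x -> ln x^-1 = - ln x.
Proof.
move=> hx; apply/eqP; rewrite -addr_eq0 -lnM_gt0 ?invr_gt0 // mulVf ?lt0r_neq0 //.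
by rewrite ln1.
Qed.

(** The upper bound is ln z <= z - 1 at z = v / u, the lower one follows by exchanging u and v.
    These bounds stand in for the derivative of the logarithm. *)
Lemma ln_sub (u v : R) : 0 < u -> 0 < v ->
  (v - u) / v <= ln v - ln u <= (v - u) / u.
Proof.
have le x y : 0 < x -> 0 < y -> ln y - ln x <= (y - x) / x.
  move=> hx hy; rewrite -(lnV_gt0 hx) -lnM_gt0 ?invr_gt0 //.
  apply: le_trans (ln_le_subr1 _) _; first by rewrite mulr_gt0 ?invr_gt0.
  by rewrite mulrBl divff ?gt_eqF.
move=> hu hv; rewrite le // andbT.
have := le _ _ hv hu; rewrite -lerN2 opprB => h; apply: le_trans h.
by rewrite -mulNr opprB.
Qed.

Lemma ler_ln (u v : R) : 0 < u -> u <= v -> ln u <= ln v.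
Proof.
move=> hu huv; have hv := lt_le_trans hu huv.
have /andP[h _] := ln_sub hu hv; rewrite -subr_ge0; apply: le_trans h.
by rewrite divr_ge0 ?subr_ge0 // ltW.
Qed.

Lemma ln_prod (I : finType) (f : I -> R) : (forall i, 0 < f i) ->
  ln (\prod_i f i) = \sum_i ln (f i).
Proof.
move=> hf; suff [] : 0 < \prod_i f i /\ ln (\prod_i f i) = \sum_i ln (f i) by [].
apply: (big_ind2 (fun (x y : R) => 0 < x /\ ln x = y)).
- by split; [exact: ltr01 | exact: ln1].
- by move=> x1 x2 y1 y2 [h1 <-] [h2 <-]; rewrite mulr_gt0 // lnM_gt0.
- by move=> i _.
Qed.

(** Its derivative is v / (1 + v)^2, so that d mt is the measure dl / (l (1 + l)^2) after the
    substitution l = 1 / v. *)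
Definition mt (v : R) : R := ln (1 + v) - v / (1 + v).

(** The derivative of [mt] at w is w times that of - 1 / (1 + w), and w <= v on the interval. *)
Lemma mtB_le u v : 0 <= u -> u <= v -> mt v - mt u <= v * ((1 + u)^-1 - (1 + v)^-1).
Proof.
move=> hu huv; have hu1 : 0 < 1 + u by lra. have hv1 : 0 < 1 + v by lra.
have /andP[_ h] := ln_sub hu1 hv1; rewrite /mt.
have -> : v * ((1 + u)^-1 - (1 + v)^-1) =
   ((1 + v) - (1 + u)) / (1 + u) - v / (1 + v) + u / (1 + u).
  by field; rewrite !gt_eqF.
lra.
Qed.

Lemma mt_homo u v : 0 <= u -> u <= v -> mt u <= mt v.
Proof.
move=> hu huv; have hu1 : 0 < 1 + u by lra. have hv1 : 0 < 1 + v by lra.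
have /andP[h _] := ln_sub hu1 hv1.
have e : ((1 + v) - (1 + u)) / (1 + v) - v / (1 + v) + u / (1 + u) =
   u * ((1 + u)^-1 - (1 + v)^-1).
  by field; rewrite !gt_eqF.
have : 0 <= u * ((1 + u)^-1 - (1 + v)^-1).
  by rewrite mulr_ge0 // subr_ge0 lef_pV2 ?posrE // lerD2l.
rewrite -e /mt; lra.
Qed.

Lemma mt0 : mt 0 = 0.
Proof. by rewrite /mt addr0 ln1 mul0r subr0. Qed.

Lemma mt_ge0 v : 0 <= v -> 0 <= mt v.
Proof. by move=> hv; rewrite -mt0 mt_homo. Qed.

Lemma mt_le_sqr v : 0 <= v -> mt v <= v ^+ 2.
Proof.
move=> hv; have := mtB_le (lexx 0) hv; rewrite mt0 subr0 addr0 invr1 => h.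
apply: le_trans h _; rewrite expr2 ler_wpM2l //.
have h1 : 0 < 1 + v by lra.
have -> : 1 - (1 + v)^-1 = v / (1 + v) by field; rewrite gt_eqF.
by rewrite ler_pdivrMr // ler_peMr // lerDl.
Qed.

Lemma mt_lip u v : 0 <= u -> u <= v -> mt v - mt u <= v - u.
Proof.
move=> hu huv; apply: le_trans (mtB_le hu huv) _.
have hu1 : 0 < 1 + u by lra. have hv1 : 0 < 1 + v by lra.
have -> : v * ((1 + u)^-1 - (1 + v)^-1) = (v - u) * (v / ((1 + u) * (1 + v))).
  by field; rewrite !gt_eqF.
rewrite ler_piMr ?subr_ge0 // ler_pdivrMr ?mulr_gt0 // mul1r; nra.
Qed.

(** * Limits and increments with small error *)

Lemma le_of_small (x y B d : R) : 0 < d ->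
  (forall e, 0 < e -> e <= d -> x <= y + B * e) -> x <= y.
Proof.
move=> hd h; apply/ler_addgt0Pr => e e0.
have B0 : 0 < `|B| + 1 by rewrite ltr_wpDl.
pose e' := Num.min d (e / (`|B| + 1)).
have e'0 : 0 < e' by rewrite lt_min hd divr_gt0.
have := h e' e'0; rewrite ge_min lexx => /(_ isT) h1; apply: le_trans h1 _.
rewrite lerD2l; apply: (@le_trans _ _ ((`|B| + 1) * e')).
  apply: ler_wpM2r; first exact: ltW.
  by apply: le_trans (ler_norm B) _; rewrite lerDl.
by rewrite mulrC -ler_pdivlMr // ge_min lexx orbT.
Qed.

Lemma le_of_inv_nat (x y B : R) :
  (forall N, (0 < N)%N -> x <= y + B / N%:R) -> x <= y.
Proof.
move=> h; apply/ler_addgt0Pr => e e0.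
have [N _ hN] : exists2 N, (0 < N)%N & `|B| / e < N%:R.
  exists (Num.bound (`|B| / e)).+1 => //.
  apply: (lt_le_trans (archi_boundP _)); first by rewrite divr_ge0 // ltW.
  by rewrite ler_nat.
have N0 : (0 : R) < N%:R by apply: le_lt_trans hN; rewrite divr_ge0 // ltW.
have := h N; rewrite -(ltr0n R) => /(_ N0) h1; apply: le_trans h1 _.
rewrite lerD2l ler_pdivrMr // (le_trans (ler_norm B)) // mulrC -ler_pdivrMr //.
exact: ltW.
Qed.

(** Replaces integration of a derivative bound: over N equal steps the quadratic errors add up to at
    most |B| (X - d)^2 / N, which vanishes as N grows. *)
Lemma quadratic_increments (f : R -> R) (d X eps B : R) : d <= X ->
  (forall x x', d <= x -> x <= x' -> x' <= X ->
     f x' - f x <= eps * (x' - x) + B * (x' - x) ^+ 2) ->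
  f X - f d <= eps * (X - d).
Proof.
move=> hdX hf.
have key (N : nat) : (0 < N)%N -> f X - f d <= eps * (X - d) + `|B| * (X - d) ^+ 2 / N%:R.
  move=> hN; have hN' : (0 : R) < N%:R by rewrite ltr0n.
  pose h := (X - d) / N%:R.
  have hh : 0 <= h by rewrite divr_ge0 ?subr_ge0 // ltW.
  have hNh : N%:R * h = X - d by rewrite /h mulrC divfK // gt_eqF.
  have steps (k : nat) : (k <= N)%N ->
      f (d + k%:R * h) - f d <= k%:R * (eps * h + `|B| * h ^+ 2).
    elim: k => [|k IH] hk; first by rewrite !mul0r addr0 subrr.
    have := IH (ltnW hk).
    have k0 : (0 : R) <= k%:R by rewrite ler0n.
    have kN : k.+1%:R * h <= X - d by rewrite -hNh ler_wpM2r // ler_nat.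
    have kh : 0 <= k%:R * h by rewrite mulr_ge0.
    rewrite -natr1 mulrDl mul1r in kN *.
    have := hf (d + k%:R * h) (d + (k%:R * h + h)).
    have -> : d + (k%:R * h + h) - (d + k%:R * h) = h by ring.
    move=> /(_ ltac:(lra) ltac:(lra) ltac:(lra)) h1 h2.
    have h3 : B * h ^+ 2 <= `|B| * h ^+ 2 by rewrite ler_wpM2r ?ler_norm // exprn_ge0.
    rewrite mulrDl mul1r; lra.
  have := steps N (leqnn N); rewrite hNh (_ : d + (X - d) = X); last by ring.
  move=> hs; apply: le_trans hs _.
  rewrite mulrDr mulrCA hNh lerD2l mulrCA.
  have -> : N%:R * h ^+ 2 = (X - d) ^+ 2 / N%:R; last by rewrite mulrA.
    by rewrite /h; field; rewrite gt_eqF.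
by apply: (@le_of_inv_nat _ _ (`|B| * (X - d) ^+ 2)) => N; exact: key.
Qed.

(** The remainder of the first-order expansion of (q + x) ln (u + x) at x = 0. It is nonnegative
    because this function is convex when q <= u. *)
Lemma xlnx_increment (q u h : R) : 0 < u -> 0 < u + h -> 0 <= q <= u -> 0 <= q + h ->
  0 <= (q + h) * ln (u + h) - q * ln u - h * (ln u + q / u) <= h ^+ 2 / u.
Proof.
move=> hu huh /andP[q0 qu] qh.
have /andP[h1 h2] := ln_sub hu huh.
rewrite (_ : u + h - u = h) in h1 h2; last by ring.
have -> : (q + h) * ln (u + h) - q * ln u - h * (ln u + q / u) =
  (q + h) * (ln (u + h) - ln u) - h * q / u by ring.
have h3 := ler_wpM2l qh h1; have h4 := ler_wpM2l qh h2; apply/andP; split.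
  rewrite subr_ge0; apply: le_trans h3; rewrite -subr_ge0.
  have -> : (q + h) * (h / (u + h)) - h * q / u = h ^+ 2 * ((u - q) / (u * (u + h))).
    by field; rewrite !gt_eqF.
  apply: mulr_ge0; first exact: sqr_ge0.
  by apply: divr_ge0; [rewrite subr_ge0 | exact: ltW (mulr_gt0 hu huh)].
rewrite lerBlDr; apply: le_trans h4 _.
have -> : h ^+ 2 / u + h * q / u = (q + h) * (h / u) by ring.
exact: lexx.
Qed.

(** * The function [Phi], its derivative and the weights of the layers *)

Section PencilData.
Variable n : nat.
Implicit Types a p y : 'I_n -> R.

(* [a] and [y] are the eigenvalues of A and A + S, and [p] is the diagonal of A
   in the eigenbasis of A + S, so that the value at 0 is k(A). *)
Definition Phi a p y (x : R) : R :=
  \sum_j (p j + x) * ln (y j + x) - \sum_i (a i + x) * ln (a i + x).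

Definition dPhi a p y (x : R) : R :=
  \sum_j (ln (y j + x) + (p j + x) / (y j + x)) - \sum_i (ln (a i + x) + 1).

(** Each of the two sums has a remainder between 0 and n h^2 / d by [xlnx_increment], so the
    difference of the remainders lies within that distance of 0. *)
Lemma Phi_increment a p y (d x h : R) :
  (forall i, 0 <= a i) -> (forall j, 0 <= p j <= y j) ->
  0 < d -> d <= x -> d <= x + h ->
  - (n%:R * (h ^+ 2 / d)) <= Phi a p y (x + h) - Phi a p y x - h * dPhi a p y x
    <= n%:R * (h ^+ 2 / d).
Proof.
move=> ha hp hd hx hxh.
have step q u : 0 <= q <= u ->
   0 <= (q + (x + h)) * ln (u + (x + h)) - (q + x) * ln (u + x) -
     h * (ln (u + x) + (q + x) / (u + x)) <= h ^+ 2 / d.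
  move=> /andP[q0 qu].
  have /andP[h1 h2] := @xlnx_increment (q + x) (u + x) h
     ltac:(lra) ltac:(lra) ltac:(lra) ltac:(lra).
  rewrite !addrA h1; apply: le_trans h2 _.
  by rewrite ler_wpM2l ?sqr_ge0 // lef_pV2 ?posrE //; lra.
have -> : Phi a p y (x + h) - Phi a p y x - h * dPhi a p y x =
  (\sum_j ((p j + (x + h)) * ln (y j + (x + h)) - (p j + x) * ln (y j + x) -
     h * (ln (y j + x) + (p j + x) / (y j + x)))) -
  (\sum_i ((a i + (x + h)) * ln (a i + (x + h)) - (a i + x) * ln (a i + x) -
     h * (ln (a i + x) + 1))).
  by rewrite /Phi /dPhi !sumrB -!mulr_sumr; ring.
set P := \sum_j _; set Q := \sum_i _.
have bd (F : 'I_n -> R) : (forall i, 0 <= F i <= h ^+ 2 / d) ->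
    0 <= \sum_i F i <= n%:R * (h ^+ 2 / d).
  move=> hF; apply/andP; split; first by apply: sumr_ge0 => i _; case/andP: (hF i).
  rewrite mulr_natl -[X in _ *+ X](card_ord n) -sumr_const.
  by apply: ler_sum => i _; case/andP: (hF i).
have /andP[P0 P1] : 0 <= P <= n%:R * (h ^+ 2 / d) by apply: bd => j; exact: step.
have /andP[Q0 Q1] : 0 <= Q <= n%:R * (h ^+ 2 / d).
  apply: bd => i; have := step (a i) (a i).
  by rewrite ha lexx divff; [apply | rewrite gt_eqF //; have := ha i; lra].
by apply/andP; split; lra.
Qed.

(** The logarithm of the product identity yields the terms ln (1 + nu), and the sum identity yields
    the terms nu / (1 + nu), since (p + x) / (y + x) = 1 - (y - p) / (y + x). *)
Lemma dPhi_mt a p y (x : R) (nu : 'I_n -> R) : 0 < x ->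
  (forall i, 0 <= a i) -> (forall j, 0 <= p j <= y j) -> (forall i, 0 <= nu i) ->
  \prod_j (y j + x) = \prod_i (a i + x) * \prod_i (1 + nu i) ->
  \sum_j (y j - p j) / (y j + x) = \sum_i nu i / (1 + nu i) ->
  dPhi a p y x = \sum_i mt (nu i).
Proof.
move=> hx ha hp hnu hprod hsum.
have y0 j : 0 < y j + x by case/andP: (hp j) => ? ?; lra.
have a0 i : 0 < a i + x by have := ha i; lra.
have nu0 i : 0 < 1 + nu i by have := hnu i; lra.
have := congr1 ln hprod; rewrite lnM_gt0 ?prodr_gt0 // !ln_prod // => e.
rewrite /mt sumrB -hsum /dPhi !big_split /= e.
have -> : \sum_j (p j + x) / (y j + x) = \sum_j (1 - (y j - p j) / (y j + x)).
  by apply: eq_bigr => j _; field; rewrite gt_eqF.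
by rewrite sumrB; ring.
Qed.

Section Grid.
Variables (th : nat -> R) (J : nat).
Hypothesis th_homo : forall i j, (i <= j)%N -> th i <= th j.
Hypothesis th0 : 0 <= th 0%N.

Let th_ge0 j : 0 <= th j.
Proof. by apply: le_trans (th_homo (leq0n j)). Qed.

Definition dmt j := mt (th j.+1) - mt (th j).

Lemma dmt_ge0 j : 0 <= dmt j.
Proof. by rewrite subr_ge0 mt_homo // th_homo. Qed.

(** The values of [mt] at min (v, th_j) telescope; a cell counts in full only if its right end is
    below v. *)
Lemma layer_lower v : 0 <= v -> \sum_(0 <= j < J) dmt j * (th j.+1 < v)%R%:R <= mt v.
Proof.
move=> hv.
apply: (@le_trans _ _ (\sum_(0 <= j < J) (mt (Num.min v (th j.+1)) - mt (Num.min v (th j))))).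
  apply: ler_sum_nat => j _; case: (boolP (_ < v)) => [h|/negbTE h].
    by rewrite mulr1 !min_r // ltW // (le_lt_trans _ h) // th_homo.
  rewrite mulr0 subr_ge0 mt_homo // ?le_min ?hv ?th_ge0 //.
  by rewrite !ge_min lexx th_homo ?orbT.
rewrite telescope_sumr //.
apply: (@le_trans _ _ (mt (Num.min v (th J)))).
  by rewrite lerBlDr lerDl mt_ge0 // le_min hv th_ge0.
by rewrite mt_homo ?le_min ?hv ?th_ge0 // ge_min lexx.
Qed.

(** Testing the left end counts the cell that contains v in full, which overestimates; the part of
    [mt] below the grid is the extra term. *)
Lemma layer_upper v : 0 <= v -> v <= th J ->
  mt v <= mt (th 0%N) + \sum_(0 <= j < J) dmt j * (th j < v)%R%:R.
Proof.
move=> hv hJ.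
apply: (@le_trans _ _ (mt (th 0%N) +
   \sum_(0 <= j < J) (mt (Num.min v (th j.+1)) - mt (Num.min v (th j))))).
  rewrite telescope_sumr // [X in mt X - _]min_l // addrCA lerDl subr_ge0.
  by rewrite mt_homo ?le_min ?hv ?th_ge0 // ge_min lexx orbT.
rewrite lerD2l; apply: ler_sum_nat => j _; case: (boolP (_ < v)) => [h|/negbTE h].
  rewrite mulr1 /dmt [Num.min v (th j)]min_r ?(ltW h) // lerD2r mt_homo //.
    by rewrite le_min hv th_ge0.
  by rewrite ge_min lexx orbT.
have hv' : v <= th j by rewrite leNgt h.
rewrite mulr0 [Num.min v (th j)]min_l // min_l ?subrr //.
by apply: le_trans (th_homo (leqnSn j)); rewrite leNgt h.
Qed.

End Grid.
End PencilData.

(** * [Phi] between two layer sums *)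

Section LayerCake.
Variable n : nat.
Implicit Types a p y : 'I_n -> R.

(** Tr (X - x)_+ for a Hermitian X with eigenvalues e. *)
Definition posum (e : 'I_n -> R) (x : R) : R := \sum_i Num.max (e i - x) 0.

Lemma posum_ge0 e x : 0 <= posum e x.
Proof. by apply: sumr_ge0 => i _; rewrite le_max lexx orbT. Qed.

(** The slope in x is minus the number of e_i above x, and that number decreases in x, so its values
    at the two ends bound the increment. *)
Lemma posum_increment (e : 'I_n -> R) (x x' : R) : x <= x' ->
  - ((x' - x) * #|[pred i | x < e i]|%:R) <= posum e x' - posum e x
    <= - ((x' - x) * #|[pred i | x' < e i]|%:R).
Proof.
move=> hx.
have cardE (z : R) : #|[pred i | z < e i]|%:R = \sum_i (z < e i)%R%:R :> R.
  by rewrite -sum1_card natr_sum big_mkcond; apply: eq_bigr => i _; rewrite inE; case: ifP.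
rewrite !cardE /posum !mulr_sumr -sumrB -!sumrN; apply/andP; split; apply: ler_sum => i _.
  case: (ltP x (e i)) => h1; rewrite ?mulr1 ?mulr0 ?oppr0 /Num.max; case: ifP; case: ifP; lra.
case: (ltP x' (e i)) => h1; rewrite ?mulr1 ?mulr0 ?oppr0 /Num.max; case: ifP; case: ifP; lra.
Qed.

(* [nu] are the eigenvalues of the pencil (S, A + x), and [e th] those of
   S / th - A; the last clause is Sylvester's law of inertia. *)
Definition pencil_data a p y (c : R) (e : R -> 'I_n -> R) : Prop :=
  [/\ forall i, 0 <= a i, forall j, 0 <= p j <= y j &
   forall x : R, 0 < x -> exists nu : 'I_n -> R,
   [/\ forall i, 0 <= nu i <= c / x,
     \prod_j (y j + x) = \prod_i (a i + x) * \prod_i (1 + nu i),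
     \sum_j (y j - p j) / (y j + x) = \sum_i nu i / (1 + nu i)
   & forall th : R, 0 < th -> #|[pred i | th < nu i]| = #|[pred i | x < e th i]| ]].

Variables (a p y : 'I_n -> R) (c : R) (e : R -> 'I_n -> R).
Hypothesis data : pencil_data a p y c e.
Variables (th : nat -> R) (J : nat).
Hypothesis th_homo : forall i j, (i <= j)%N -> th i <= th j.
Hypothesis th0 : 0 < th 0%N.

Let th_gt0 j : 0 < th j.
Proof. by apply: lt_le_trans (th_homo (leq0n j)). Qed.

Let card_nu (nu : 'I_n -> R) (v : R) :
  #|[pred i | v < nu i]|%:R = \sum_i (v < nu i)%R%:R :> R.
Proof.
by rewrite -sum1_card natr_sum big_mkcond; apply: eq_bigr => i _; rewrite inE; case: ifP.
Qed.

Lemma dPhi_lower (x : R) : 0 < x ->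
  \sum_(0 <= j < J) dmt th j * #|[pred i | x < e (th j.+1) i]|%:R <= dPhi a p y x.
Proof.
case: data => ha hp hd hx; have [nu [hnu hprod hsum hcnt]] := hd x hx.
rewrite (@dPhi_mt _ a p y x nu) //; last by move=> i; case/andP: (hnu i).
rewrite (eq_bigr (fun j => \sum_i dmt th j * (th j.+1 < nu i)%R%:R)); last first.
  by move=> j _; rewrite -hcnt // card_nu mulr_sumr.
rewrite exchange_big; apply: ler_sum => i _; case/andP: (hnu i) => h1 h2.
by apply: layer_lower => //; exact: ltW.
Qed.

Lemma dPhi_upper (x : R) : 0 < x -> c / x <= th J ->
  dPhi a p y x <= n%:R * mt (th 0%N) +
    \sum_(0 <= j < J) dmt th j * #|[pred i | x < e (th j) i]|%:R.
Proof.
case: data => ha hp hd hx hJ; have [nu [hnu hprod hsum hcnt]] := hd x hx.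
rewrite (@dPhi_mt _ a p y x nu) //; last by move=> i; case/andP: (hnu i).
rewrite (eq_bigr (fun j => \sum_i dmt th j * (th j < nu i)%R%:R)); last first.
  by move=> j _; rewrite -hcnt // card_nu mulr_sumr.
rewrite exchange_big mulr_natl -[X in _ *+ X](card_ord n) -sumr_const -big_split.
apply: ler_sum => i _; case/andP: (hnu i) => h1 h2.
by apply: layer_upper => //; [exact: ltW | exact: le_trans h2 hJ].
Qed.

(** [dPhi_lower] integrated over x: minus the function [Phi] plus layer sum has increments with only
    a quadratic error, so it does not grow. *)
Lemma Phi_layer_lower (d X : R) : 0 < d -> d <= X ->
  0 <= Phi a p y X - Phi a p y d +
    \sum_(0 <= j < J) dmt th j * (posum (e (th j.+1)) X - posum (e (th j.+1)) d).
Proof.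
move=> hd hdX; case: (data) => ha hp _.
pose f x := - (Phi a p y x + \sum_(0 <= j < J) dmt th j * posum (e (th j.+1)) x).
have := @quadratic_increments f d X 0 (n%:R / d) hdX.
rewrite mul0r => H; rewrite -oppr_le0; apply: le_trans (H _).
  rewrite /f le_eqVlt; apply/orP; left; apply/eqP.
  under [in LHS]eq_bigr => j _ do rewrite mulrBr.
  by rewrite sumrB; ring.
move=> x x' hx hxx' _.
have hx0 : 0 < x by lra.
have := @Phi_increment _ a p y d x (x' - x) ha hp hd hx ltac:(lra).
rewrite (_ : x + (x' - x) = x'); last by ring.
move=> /andP[h1 _].
have h2 := dPhi_lower hx0.
have h3 : (x' - x) * (\sum_(0 <= j < J) dmt th j * #|[pred i | x < e (th j.+1) i]|%:R) +
   (\sum_(0 <= j < J) dmt th j * posum (e (th j.+1)) x' -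
    \sum_(0 <= j < J) dmt th j * posum (e (th j.+1)) x) >= 0.
  rewrite mulr_sumr -sumrB -big_split; apply: sumr_ge0 => j _.
  have /andP[h _] := posum_increment (e (th j.+1)) hxx'.
  have := ler_wpM2l (dmt_ge0 th_homo (ltW th0) j) h; rewrite /=; lra.
have h4 := ler_wpM2l (_ : 0 <= x' - x) h2; rewrite subr_ge0 in h4; have {}h4 := h4 hxx'.
have -> : n%:R / d * (x' - x) ^+ 2 = n%:R * ((x' - x) ^+ 2 / d) by ring.
rewrite /f; lra.
Qed.

Lemma Phi_layer_upper (d X : R) : 0 < d -> d <= X -> 0 <= c -> c / d <= th J ->
  Phi a p y X - Phi a p y d +
    \sum_(0 <= j < J) dmt th j * (posum (e (th j)) X - posum (e (th j)) d)
  <= n%:R * mt (th 0%N) * (X - d).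
Proof.
move=> hd hdX hc hJ; case: (data) => ha hp _.
pose f x := Phi a p y x + \sum_(0 <= j < J) dmt th j * posum (e (th j)) x.
have := @quadratic_increments f d X (n%:R * mt (th 0%N)) (n%:R / d) hdX.
move=> H; apply: le_trans (H _).
  rewrite /f le_eqVlt; apply/orP; left; apply/eqP.
  under [in LHS]eq_bigr => j _ do rewrite mulrBr.
  by rewrite sumrB; ring.
move=> x x' hx hxx' _.
have hx0 : 0 < x' by lra.
(* The expansion is taken at the right end x', where the count bounds the decrease of [posum] from
   below. *)
have := @Phi_increment _ a p y d x' (x - x') ha hp hd ltac:(lra) ltac:(lra).
rewrite (_ : x' + (x - x') = x); last by ring.
move=> /andP[h1 _].
have hJ' : c / x' <= th J.
  by apply: le_trans hJ; rewrite ler_wpM2l // lef_pV2 ?posrE //; lra.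
have h2 := dPhi_upper hx0 hJ'.
have h3 : (x' - x) * (\sum_(0 <= j < J) dmt th j * #|[pred i | x' < e (th j) i]|%:R) +
   (\sum_(0 <= j < J) dmt th j * posum (e (th j)) x' -
    \sum_(0 <= j < J) dmt th j * posum (e (th j)) x) <= 0.
  rewrite mulr_sumr -sumrB -big_split; apply: sumr_le0 => j _.
  have /andP[_ h] := posum_increment (e (th j)) hxx'.
  have := ler_wpM2l (dmt_ge0 th_homo (ltW th0) j) h; rewrite /=; lra.
have h4 := ler_wpM2l (_ : 0 <= x' - x) h2; rewrite subr_ge0 in h4; have {}h4 := h4 hxx'.
have -> : n%:R / d * (x' - x) ^+ 2 = n%:R * ((x - x') ^+ 2 / d) by ring.
rewrite /f; lra.
Qed.

End LayerCake.

(** The sum form of the integral of min (t, l c) against the layer measure. *)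
Lemma layer_cake_le (th : nat -> R) (J : nat) (m : nat -> R) (t c : R) :
  (forall i j, (i <= j)%N -> th i <= th j) -> 0 < th 0%N -> 0 <= t -> 0 <= c ->
  (forall j, m j <= t) -> (forall j, m j <= c / th j.+1) ->
  \sum_(0 <= j < J) dmt th j * m j <= t * ln (1 + c / t).
Proof.
move=> hth th0 t0 c0 hmt hmc.
have thp j : 0 < th j by apply: lt_le_trans (hth _ _ (leq0n j)).
(* At t = 0 the quotient c / t is a default value, but the factor t makes the bound 0. *)
have [t00|tp] : t = 0 \/ 0 < t by move: t0; rewrite le_eqVlt => /orP[/eqP <-|]; [left|right].
  rewrite t00 mul0r; apply: sumr_le0 => j _.
  apply: mulr_ge0_le0; first by apply: dmt_ge0 => //; exact: ltW.
  by rewrite -t00.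
set r := c / t; have r0 : 0 <= r by rewrite divr_ge0.
have tr : t * r = c by rewrite /r mulrCA divff ?mulr1 // gt_eqF.
(* An antiderivative of min (t, c / v) against d mt: the minimum is t below r = c / t, and above r
   the integrand c / (1 + v)^2 has antiderivative - c / (1 + v). *)
pose K v := t * mt (Num.min v r) - c / (1 + Num.max v r).
have step j : dmt th j * m j <= K (th j.+1) - K (th j).
  have h1 := hth _ _ (leqnSn j); have h0 := thp j; have h2 := thp j.+1.
  have hm1 := hmt j; have hm2 := hmc j.
  have le1 : (mt (Num.min (th j.+1) r) - mt (Num.min (th j) r)) * m j <=
      t * mt (Num.min (th j.+1) r) - t * mt (Num.min (th j) r).
    have mi0 : 0 <= Num.min (th j) r by rewrite le_min r0 ltW.
    have mi1 : Num.min (th j) r <= Num.min (th j.+1) r.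
      by rewrite le_min !ge_min lexx h1 ?orbT.
    have := mt_homo mi0 mi1; rewrite -subr_ge0 => h.
    have := ler_wpM2l h hm1; lra.
  have le2 : (mt (Num.max (th j.+1) r) - mt (Num.max (th j) r)) * m j <=
      c / (1 + Num.max (th j) r) - c / (1 + Num.max (th j.+1) r).
    case: (leP (th j.+1) r) => h3.
      by rewrite max_r ?(le_trans h1) // !subrr mul0r.
    set u := Num.max (th j) r.
    have hu0 : 0 <= u by rewrite le_max r0 orbT.
    have hu : u <= th j.+1 by rewrite ge_max h1 ltW.
    have h4 := mtB_le hu0 hu.
    have h5 : 0 <= mt (th j.+1) - mt u by rewrite subr_ge0 mt_homo.
    apply: le_trans (ler_wpM2l h5 hm2) _.
    have h6 : 0 <= c / th j.+1 by rewrite divr_ge0 // ltW.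
    apply: le_trans (ler_wpM2r h6 h4) _.
    rewrite le_eqVlt; apply/orP; left; apply/eqP; field.
    by rewrite !gt_eqF //; lra.
  have -> : dmt th j * m j =
     (mt (Num.min (th j.+1) r) - mt (Num.min (th j) r)) * m j +
     (mt (Num.max (th j.+1) r) - mt (Num.max (th j) r)) * m j.
    (* Splitting [mt] at r separates the two regimes, also in the cell that contains r. *)
    have sp v : mt v = mt (Num.min v r) + mt (Num.max v r) - mt r.
      by case: (leP v r) => h; ring.
    by rewrite /dmt (sp (th j.+1)) (sp (th j)); ring.
  rewrite /K; lra.
apply: le_trans (ler_sum_nat (fun j _ => step j)) _.
rewrite telescope_sumr // /K.
have k1 : 0 <= t * mt (Num.min (th 0%N) r).
  by rewrite mulr_ge0 // mt_ge0 // le_min r0 ltW.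
have k2 : t * mt (Num.min (th J) r) <= t * mt r.
  apply: ler_wpM2l => //; apply: mt_homo; first by rewrite le_min r0 ltW.
  by rewrite ge_min lexx orbT.
have k3 : 0 <= c / (1 + Num.max (th J) r).
  by rewrite divr_ge0 // addr_ge0 // le_max r0 orbT.
have k4 : c / (1 + Num.max (th 0%N) r) <= c / (1 + r).
  rewrite ler_wpM2l // lef_pV2 ?posrE ?lerD2l ?le_max ?lexx ?orbT //.
    by rewrite ltr_pwDl // le_max r0 orbT.
  by rewrite ltr_pwDl.
have k5 : t * mt r + c / (1 + r) = t * ln (1 + r).
  by rewrite /mt -tr; field; rewrite gt_eqF // ltr_pwDl.
lra.
Qed.

(** * [Phi] at infinity and near zero *)

Section PhiLimits.
Variable n : nat.
Variables a p y : 'I_n -> R.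
Hypothesis a_ge0 : forall i, 0 <= a i.
Hypothesis p_bnd : forall j, 0 <= p j <= y j.

(** Each term (q + X) ln (u + X) is (q + X) ln X + u up to u^2 / X, and the multiples of ln X cancel
    because p and a have the same sum. *)
Lemma Phi_large : \sum_j p j = \sum_i a i -> exists B : R, forall X : R, 0 < X ->
  `|Phi a p y X - (\sum_j y j - \sum_i a i)| <= B / X.
Proof.
move=> hpa.
exists (\sum_j ((y j) ^+ 2) + \sum_i ((a i) ^+ 2)) => X hX.
have step q u : 0 <= q <= u -> `|(q + X) * ln (u + X) - (q + X) * ln X - u| <= u ^+ 2 / X.
  move=> /andP[q0 qu]; have huX : 0 < u + X by lra.
  have /andP[h1 h2] := ln_sub hX huX.
  rewrite (_ : u + X - X = u) in h1 h2; last by ring.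
  have qX : 0 <= q + X by lra.
  have h3 := ler_wpM2l qX h1; have h4 := ler_wpM2l qX h2.
  have h5 : u - u ^+ 2 / X <= (q + X) * (u / (u + X)).
    rewrite -subr_ge0.
    have -> : (q + X) * (u / (u + X)) - (u - u ^+ 2 / X) =
       u * (X * q + u * u) / ((u + X) * X) by field; rewrite !gt_eqF.
    rewrite divr_ge0 // ?mulr_ge0 ?addr_ge0 ?mulr_ge0 //; lra.
  have h6 : (q + X) * (u / X) <= u + u ^+ 2 / X.
    rewrite -subr_ge0.
    have -> : u + u ^+ 2 / X - (q + X) * (u / X) = u * (u - q) / X.
      by field; rewrite gt_eqF.
    rewrite divr_ge0 // ?mulr_ge0 ?subr_ge0 //; lra.
  by rewrite ler_norml; apply/andP; split; lra.
have bd (I : finType) (q u : I -> R) : (forall i, 0 <= q i <= u i) ->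
   `|\sum_i ((q i + X) * ln (u i + X)) - \sum_i ((q i + X) * ln X) - \sum_i u i| <=
   \sum_i (u i) ^+ 2 / X.
  move=> hq; rewrite -!sumrB; apply: le_trans (ler_norm_sum _ _ _) _.
  by apply: ler_sum => i _; exact: step.
have h1 := bd _ p y p_bnd.
have h2 := bd _ a a ltac:(by move=> i; rewrite a_ge0 lexx).
have e : \sum_i (p i + X) * ln X = \sum_i (a i + X) * ln X.
  by rewrite -!mulr_suml !big_split /= hpa.
rewrite mulrDl !mulr_suml /Phi.
apply: le_trans (lerD h1 h2); apply: le_trans (ler_normB _ _).
by rewrite e le_eqVlt; apply/orP; left; apply/eqP; congr `|_|; ring.
Qed.

(** The argument is a square so that the error is linear: |x ln x| <= 2 z for x = z^2 and 0 < z <=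
    1, as ln (1 / z) <= 1 / z. *)
Lemma Phi_small : exists B : R, forall z : R, 0 < z -> z <= 1 ->
  `|Phi a p y (z ^+ 2) - Phi a p y 0| <= B * z.
Proof.
exists (\sum_j (4 + y j) + \sum_i (4 + a i)) => z hz hz1.
set x := z ^+ 2; have hx : 0 < x by rewrite exprn_gt0.
have hxz : x <= z by rewrite /x expr2 ler_piMr // ltW.
have step q u : 0 <= q <= u ->
   `|(q + x) * ln (u + x) - (q + 0) * ln (u + 0)| <= (4 + u) * z.
  move=> /andP[q0 qu]; rewrite !addr0.
  have hux : 0 < u + x by lra.
  have h1 : `|q * (ln (u + x) - ln u)| <= x.
    have [u0|u0] : u = 0 \/ 0 < u.
      have : 0 <= u by lra.
      by rewrite le_eqVlt => /orP[/eqP <-|]; [left|right].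
      have -> : q = 0 by lra.
      by rewrite mul0r normr0 ltW.
    have /andP[h1 h2] := ln_sub u0 hux.
    rewrite (_ : u + x - u = x) in h1 h2; last by ring.
    have h3 : 0 <= ln (u + x) - ln u by apply: le_trans h1; rewrite divr_ge0 // ltW.
    rewrite ger0_norm ?mulr_ge0 //.
    apply: le_trans (ler_wpM2l q0 h2) _.
    rewrite mulrA ler_pdivrMr // mulrC ler_wpM2l //; exact: ltW.
  have h2 : x * ln (u + x) <= (u + 1) * z.
    have h := ln_le_subr1 hux.
    apply: (@le_trans _ _ (x * (u + 1))); last by rewrite mulrC ler_wpM2l //; lra.
    rewrite ler_wpM2l //; lra.
  have h3 : - (2 * z) <= x * ln (u + x).
    apply: (@le_trans _ _ (x * ln x)); last first.
      by rewrite ler_wpM2l ?(ltW hx) // ler_ln // lerDr; lra.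
    have -> : ln x = - (2 * ln z^-1).
      by rewrite /x expr2 lnM_gt0 // lnV_gt0 //; ring.
    have hz' : 0 < z^-1 by rewrite invr_gt0.
    have : x * ln z^-1 <= x * z^-1.
      apply: ler_wpM2l; first exact: ltW.
      by apply: le_trans (ln_le_subr1 hz') _; rewrite lerBlDr lerDl ler01.
    have -> : x * z^-1 = z by rewrite /x; field; rewrite gt_eqF.
    lra.
  have -> : (q + x) * ln (u + x) - q * ln u = q * (ln (u + x) - ln u) + x * ln (u + x) by ring.
  apply: le_trans (ler_normD _ _) _.
  have uz : 0 <= u * z by apply: mulr_ge0; lra.
  have h4 : `|x * ln (u + x)| <= (3 + u) * z by rewrite ler_norml; apply/andP; split; lra.
  lra.
have bd (I : finType) (q u : I -> R) : (forall i, 0 <= q i <= u i) ->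
   `|\sum_i ((q i + x) * ln (u i + x)) - \sum_i ((q i + 0) * ln (u i + 0))| <=
   (\sum_i (4 + u i)) * z.
  move=> hq; rewrite -!sumrB mulr_suml; apply: le_trans (ler_norm_sum _ _ _) _.
  by apply: ler_sum => i _; exact: step.
have h1 := bd _ p y p_bnd.
have h2 := bd _ a a ltac:(by move=> i; rewrite a_ge0 lexx).
rewrite mulrDl /Phi; apply: le_trans (lerD h1 h2); apply: le_trans (ler_normB _ _).
by rewrite le_eqVlt; apply/orP; left; apply/eqP; congr `|_|; ring.
Qed.

End PhiLimits.

(** The lower layer sum for the first datum is compared with the upper one for the second on a
    common grid. Then the mesh tends to 0, the lowest level w tends to 0 with d fixed, and finally d
    tends to 0. *)
Lemma Phi_variation n (a1 p1 y1 a2 p2 y2 : 'I_n -> R) (c t : R)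
    (e1 e2 : R -> 'I_n -> R) :
  0 < c -> 0 <= t -> pencil_data a1 p1 y1 c e1 -> pencil_data a2 p2 y2 c e2 ->
  \sum_j p1 j = \sum_i a1 i -> \sum_j p2 j = \sum_i a2 i ->
  \sum_j y1 j - \sum_i a1 i = \sum_j y2 j - \sum_i a2 i ->
  (forall th x : R, 0 < th -> c / th <= x -> posum (e1 th) x = 0) ->
  (forall th x : R, 0 < th -> 0 < x -> posum (e2 th) x <= c / th) ->
  (forall th th' x : R, 0 < th -> th <= th' -> 0 < x ->
     posum (e2 th) x <= posum (e1 th') x + t + c * (th^-1 - th'^-1)) ->
  Phi a1 p1 y1 0 - Phi a2 p2 y2 0 <= t * ln (1 + c / t).
Proof.
move=> c0 t0 D1 D2 hp1 hp2 hya H0 H2 H12.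
set K := t * ln (1 + c / t).
have [a1p yp1 _] := D1; have [a2p yp2 _] := D2.
have [B1 hB1] := Phi_large a1p yp1 hp1; have [B2 hB2] := Phi_large a2p yp2 hp2.
have [S1 hS1] := Phi_small a1p yp1; have [S2 hS2] := Phi_small a2p yp2.
have step1 (d w : R) : 0 < d -> 0 < w -> w < c / d ->
    Phi a1 p1 y1 d - Phi a2 p2 y2 d <=
    K + (Phi a1 p1 y1 (c / w) - Phi a2 p2 y2 (c / w)) + n%:R * mt w * (c / w).
  move=> hd hw hwd.
  pose T := c / d; have hT : 0 < T - w by rewrite subr_gt0.
  have hdX : d <= c / w by rewrite ler_pdivlMr // mulrC -ler_pdivlMr // ltW.
  apply: (@le_of_inv_nat _ _ ((T - w) * (c / w))) => N hN.
  have hN' : (0 : R) < N%:R by rewrite ltr0n.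
  pose h := (T - w) / N%:R; have hh : 0 <= h by rewrite divr_ge0 // ltW.
  (* The grid runs from w to c / d, which dominates every pencil eigenvalue for x >= d; the largest
     x is c / w, where the layers of the first datum vanish. *)
  pose th (j : nat) : R := w + j%:R * h.
  have hth i j : (i <= j)%N -> th i <= th j.
    by move=> hij; rewrite lerD2l ler_wpM2r // ler_nat.
  have th0 : 0 < th 0%N by rewrite /th mul0r addr0.
  have thp j : 0 < th j by apply: lt_le_trans (hth _ _ (leq0n j)).
  have thN : th N = T by rewrite /th /h; field; rewrite gt_eqF.
  have L := Phi_layer_lower D1 N hth th0 hd hdX.
  have thN' : c / d <= th N by rewrite thN.
  have U := Phi_layer_upper D2 hth th0 hd hdX (ltW c0) thN'.
  (* The first datum is sampled at right ends and the second at left ends; the mismatch costs c (1 /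
     th_j - 1 / th_(j+1)), which telescopes and is multiplied by the mesh. *)
  pose m j := Num.min t (c / th j.+1).
  have bnd j : posum (e2 (th j)) d - posum (e1 (th j.+1)) d <=
      m j + c * ((th j)^-1 - (th j.+1)^-1).
    have h1 := H12 _ _ _ (thp j) (hth _ _ (leqnSn j)) hd.
    have h2 := H2 _ _ (thp j) hd.
    have h3 := posum_ge0 (e1 (th j.+1)) d.
    by rewrite /m /Num.min; case: ifP => _; lra.
  have dmt_le j : dmt th j <= h.
    apply: le_trans (mt_lip (ltW (thp j)) (hth _ _ (leqnSn j))) _.
    by rewrite /th -natr1; lra.
  have k1 : \sum_(0 <= j < N) dmt th j * m j <= K.
    apply: layer_cake_le => // [|j|j]; first exact: ltW.
      by rewrite ge_min lexx.
    by rewrite ge_min lexx orbT.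
  have k2 : \sum_(0 <= j < N) dmt th j * (c * ((th j)^-1 - (th j.+1)^-1)) <=
      (T - w) * (c / w) / N%:R.
    apply: (@le_trans _ _ (\sum_(0 <= j < N) (h * c) * (- (th j.+1)^-1 - - (th j)^-1))).
      apply: ler_sum_nat => j _.
      have i1 : 0 <= c * ((th j)^-1 - (th j.+1)^-1).
        by rewrite mulr_ge0 ?(ltW c0) // subr_ge0 lef_pV2 ?posrE ?hth.
      have := ler_wpM2r i1 (dmt_le j); lra.
    rewrite -mulr_sumr (telescope_sumr (fun j => - (th j)^-1)) //.
    have -> : th 0%N = w by rewrite /th mul0r addr0.
    have -> : (T - w) * (c / w) / N%:R = h * c * w^-1 by rewrite /h; ring.
    apply: ler_wpM2l; first by rewrite mulr_ge0 // ltW.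
    have : 0 < (th N)^-1 by rewrite invr_gt0.
    lra.
  have k3 : \sum_(0 <= j < N) dmt th j * (posum (e2 (th j)) d - posum (e1 (th j.+1)) d) <=
      \sum_(0 <= j < N) dmt th j * m j +
      \sum_(0 <= j < N) dmt th j * (c * ((th j)^-1 - (th j.+1)^-1)).
    rewrite -big_split; apply: ler_sum_nat => j _ /=.
    by rewrite -mulrDr ler_wpM2l // dmt_ge0 // ltW.
  have X1 j : posum (e1 (th j.+1)) (c / w) = 0.
    apply: H0 => //; rewrite ler_wpM2l ?(ltW c0) // lef_pV2 ?posrE //.
    by have := hth 0%N j.+1 (leq0n _); rewrite /th mul0r addr0.
  have k4 : 0 <= \sum_(0 <= j < N) dmt th j * posum (e2 (th j)) (c / w).
    by apply: sumr_ge0 => j _; rewrite mulr_ge0 ?posum_ge0 // dmt_ge0 // ltW.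
  have eL : \sum_(0 <= j < N) dmt th j * (posum (e1 (th j.+1)) (c / w) - posum (e1 (th j.+1)) d) =
      - \sum_(0 <= j < N) dmt th j * posum (e1 (th j.+1)) d.
    by rewrite -sumrN; apply: eq_bigr => j _; rewrite X1; ring.
  have eU : \sum_(0 <= j < N) dmt th j * (posum (e2 (th j)) (c / w) - posum (e2 (th j)) d) =
      \sum_(0 <= j < N) dmt th j * posum (e2 (th j)) (c / w) -
      \sum_(0 <= j < N) dmt th j * posum (e2 (th j)) d.
    by rewrite -sumrB; apply: eq_bigr => j _; ring.
  have eD : \sum_(0 <= j < N) dmt th j * (posum (e2 (th j)) d - posum (e1 (th j.+1)) d) =
      \sum_(0 <= j < N) dmt th j * posum (e2 (th j)) d -
      \sum_(0 <= j < N) dmt th j * posum (e1 (th j.+1)) d.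
    by rewrite -sumrB; apply: eq_bigr => j _; ring.
  rewrite eL in L; rewrite eU in U; rewrite eD in k3.
  have k5 : n%:R * mt (th 0%N) * (c / w - d) <= n%:R * mt w * (c / w).
    have -> : th 0%N = w by rewrite /th mul0r addr0.
    by apply: ler_wpM2l; [rewrite mulr_ge0 ?mt_ge0 ?(ltW hw) | lra].
  lra.
have step2 (d : R) : 0 < d -> Phi a1 p1 y1 d - Phi a2 p2 y2 d <= K.
  move=> hd; have hcd : 0 < c / d by rewrite divr_gt0.
  apply: (@le_of_small _ _ (B1 / c + B2 / c + n%:R * c) (c / d / 2)); first by lra.
  move=> w hw hwd; have hwd' : w < c / d by lra.
  apply: le_trans (step1 d w hd hw hwd') _.
  have hX : 0 < c / w by rewrite divr_gt0.
  have := hB1 _ hX; have := hB2 _ hX; rewrite !ler_norml => /andP[h1 h2] /andP[h3 h4].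
  have e B : B / (c / w) = B / c * w by field; rewrite !gt_eqF.
  rewrite !e in h1 h2 h3 h4.
  (* [mt] vanishes to second order at 0, which beats the factor c / w. *)
  have h5 : n%:R * mt w * (c / w) <= n%:R * c * w.
    have -> : n%:R * c * w = n%:R * w ^+ 2 * (c / w) by field; rewrite gt_eqF.
    rewrite ler_wpM2r ?(ltW hX) // ler_wpM2l // mt_le_sqr //; exact: ltW.
  lra.
apply: (@le_of_small _ _ (S1 + S2) 1) => // z hz hz1.
have := hS1 z hz hz1; have := hS2 z hz hz1; rewrite !ler_norml => /andP[h1 h2] /andP[h3 h4].
have := step2 (z ^+ 2) (exprn_gt0 2 hz); lra.
Qed.

(** * The variation bound for matrices *)

Section Telescopic.
Variable n : nat.
Local Notation M := ('M[R[i]]_n).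

Lemma eigd_ext (A U : M) l m : l =1 m -> eigd A U l -> eigd A U m.
Proof. by move=> /eq_dg e; rewrite /eigd e. Qed.

Lemma eigdN (A U : M) l : eigd A U l -> eigd (- A) U (fun i => - l i).
Proof.
move=> h; have := eigd_scale (-1) h; rewrite rmorphN1 scaleN1r.
by apply: eigd_ext => i; rewrite mulN1r.
Qed.

Lemma eigd_diag_ge0 (A S U W V : M) a s y : eigd A U a -> eigd S W s ->
  eigd (A + S) V y -> (forall i, 0 <= a i) -> (forall i, 0 <= s i) ->
  forall j, 0 <= \sum_i a i * ov U V i j <= y j.
Proof.
move=> hA hS hY a0 s0 j; rewrite (eigd_add hA hS hY) lerDl.
by apply/andP; split; apply: sumr_ge0 => i _; rewrite mulr_ge0 ?ov_ge0.
Qed.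

(** The shift by x > 0 makes A + x positive definite, so [pencil] applies to it. The differences y -
    p are the diagonal entries of S in the eigenbasis of A + S. *)
Lemma pencil_data_eigd (A S U W V : M) a s y e :
  eigd A U a -> eigd S W s -> eigd (A + S) V y ->
  (forall i, 0 <= a i) -> (forall i, 0 <= s i) ->
  (forall th : R, 0 < th -> exists F, eigd (th^-1%:C *: S - A) F (e th)) ->
  pencil_data a (fun j => \sum_i a i * ov U V i j) y (\sum_i s i) e.
Proof.
move=> hA hS hY a0 s0 he; have hp := eigd_diag_ge0 hA hS hY a0 s0.
split=> // x hx.
have y0 j : 0 < y j + x by case/andP: (hp j) => h1 h2; lra.
have eY : A + S + x%:C%:M = A + x%:C%:M + S by rewrite addrAC.
have ha i : x <= a i + x by rewrite lerDr.
have [nu [h1 h2 h3 h4]] := pencil (eigd_shift x hA) hS (eigd_shift x hY) eY hx ha s0 y0.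
exists nu; split=> //.
  rewrite -h3; apply: eq_bigr => j _; congr (_ / _).
  by rewrite (eigd_add hA hS hY) [X in X - _]addrC addrK.
move=> th th0; have [F hF] := he th th0.
have := eigd_shift (- x) hF.
have -> : th^-1%:C *: S - A + (- x)%:C%:M = th^-1%:C *: S - (A + x%:C%:M).
  by rewrite rmorphN (raddfN (@scalar_mx _ n)) opprD addrA.
move=> /(h4 th F _ th0) ->; apply: eq_card => i; rewrite !inE.
by rewrite subr_gt0.
Qed.

Lemma hermB (A B : M) : A^t* = A -> B^t* = B -> (A - B)^t* = A - B.
Proof. by move=> hA hB; rewrite linearB /= map_mxB hA hB. Qed.

Lemma hermD (A B : M) : A^t* = A -> B^t* = B -> (A + B)^t* = A + B.
Proof. by move=> hA hB; rewrite linearD /= map_mxD hA hB. Qed.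

Lemma hermZ (x : R) (A : M) : A^t* = A -> (x%:C *: A)^t* = x%:C *: A.
Proof.
move=> hA; rewrite linearZ /= map_mxZ hA; congr (_ *: _).
exact: conjc_real.
Qed.

Lemma sum_ppart0 (l : 'I_n -> R) : (forall i, l i <= 0) -> \sum_i ppart (l i) = 0.
Proof. by move=> h; apply: big1 => i _; rewrite /ppart max_r. Qed.

Lemma sum_ppart_id (l : 'I_n -> R) : (forall i, 0 <= l i) -> \sum_i ppart (l i) = \sum_i l i.
Proof. by move=> h; apply: eq_bigr => i _; rewrite /ppart max_l. Qed.

Lemma eigd_choice (A S : M) : A^t* = A -> S^t* = S ->
  exists e : R -> 'I_n -> R,
  forall th : R, 0 < th -> exists F, eigd (th^-1%:C *: S - A) F (e th).
Proof.
move=> hA hS.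
have /boolp.choice[e he] : forall th : R, exists l : 'I_n -> R,
    0 < th -> exists F, eigd (th^-1%:C *: S - A) F l.
  move=> th; have [F [l h]] := herm_eigd (hermB (hermZ th^-1 hS) hA).
  by exists l => _; exists F.
by exists e.
Qed.

(** The conditions of [Phi_variation] on the layers all come from [pos_trace_add], applied to
    decompositions of S / th - A - x. *)
Lemma telescopic_variation (A1 A2 S U1 U2 W V1 V2 Q : M) a1 a2 s y1 y2 d t :
  eigd A1 U1 a1 -> eigd A2 U2 a2 -> eigd S W s ->
  eigd (A1 + S) V1 y1 -> eigd (A2 + S) V2 y2 -> eigd (A1 - A2) Q d ->
  (forall i, 0 <= a1 i) -> (forall i, 0 <= a2 i) -> (forall i, 0 <= s i) ->
  0 < \sum_i s i -> t = \sum_i ppart (d i) ->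
  Phi a1 (fun j => \sum_i a1 i * ov U1 V1 i j) y1 0 -
  Phi a2 (fun j => \sum_i a2 i * ov U2 V2 i j) y2 0 <= t * ln (1 + (\sum_i s i) / t).
Proof.
move=> hA1 hA2 hS hY1 hY2 hD a10 a20 s0 c0 ht; set c := \sum_i s i in c0 *.
have hAh1 := eigd_herm hA1; have hAh2 := eigd_herm hA2; have hSh := eigd_herm hS.
have [e1 he1] := eigd_choice hAh1 hSh; have [e2 he2] := eigd_choice hAh2 hSh.
have sumY (A U V : M) a y : eigd A U a -> eigd (A + S) V y -> \sum_j y j - \sum_i a i = c.
  move=> hA hY; rewrite -(rtr_eigd hY) -(rtr_eigd hA) rtrD /c -(rtr_eigd hS).
  by rewrite addrC addKr.
have s_le k : s k <= c.
  by rewrite /c (bigD1 k) //= lerDl; apply: sumr_ge0.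
apply: (@Phi_variation _ _ _ _ _ _ _ c t e1 e2) => //.
- by rewrite ht; apply: sumr_ge0 => i _; rewrite le_max lexx orbT.
- exact: pencil_data_eigd hA1 hS hY1 a10 s0 he1.
- exact: pencil_data_eigd hA2 hS hY2 a20 s0 he2.
- exact: ov_sum_total hA1.1 hY1.1.
- exact: ov_sum_total hA2.1 hY2.1.
- by rewrite (sumY _ _ _ _ _ hA1 hY1) (sumY _ _ _ _ _ hA2 hY2).
- move=> th x th0 hx; have [F hF] := he1 th th0.
  apply/eqP; rewrite eq_le posum_ge0 andbT.
  have h1 := eigd_shift (- x) (eigd_scale th^-1 hS).
  have h2 := eigdN hA1; have h3 := eigd_shift (- x) hF.
  rewrite addrAC in h3; apply: le_trans (pos_trace_add h1 h2 h3) _.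
  rewrite !sum_ppart0 ?addr0 // => i; first by rewrite oppr_le0.
  (* Every eigenvalue of S is at most its trace c, so S / th - x has no positive part once x >= c /
     th. *)
  by rewrite subr_le0 mulrC (le_trans _ hx) // ler_wpM2r // invr_ge0 ltW.
- move=> th x th0 hx; have [F hF] := he2 th th0.
  have h1 := eigd_scale th^-1 hS; have h2 := eigd_shift (- x) (eigdN hA2).
  have h3 := eigd_shift (- x) hF; rewrite -addrA in h3.
  apply: le_trans (pos_trace_add h1 h2 h3) _.
  rewrite [X in _ + X]sum_ppart0 ?addr0; last first.
    by move=> i; have := a20 i; lra.
  rewrite sum_ppart_id; first by rewrite -mulr_sumr mulrC.
  by move=> i; rewrite mulr_ge0 // invr_ge0 ltW.
- move=> th th' x th0 hth hx; have th0' := lt_le_trans th0 hth.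
  have [F1 hF1] := he1 th' th0'; have [F2 hF2] := he2 th th0.
  have hb : 0 <= th^-1 - th'^-1 by rewrite subr_ge0 lef_pV2.
  have h1 := eigd_shift (- x) hF1.
  have h2 := eigd_scale (th^-1 - th'^-1) hS.
  have h3 : eigd (th^-1%:C *: S - A2 + (- x)%:C%:M) F2 (fun i => e2 th i - x) := eigd_shift (- x) hF2.
  have [G [g hG]] := herm_eigd (A := (th^-1 - th'^-1)%:C *: S + (A1 - A2))
    (hermD (hermZ _ hSh) (hermB hAh1 hAh2)).
  (* Passing from (A1, th') to (A2, th) adds A1 - A2, whose positive part has trace t, and a
     nonnegative multiple of S. *)
  have e : th^-1%:C *: S - A2 + (- x)%:C%:M =
     (th'^-1%:C *: S - A1 + (- x)%:C%:M) + ((th^-1 - th'^-1)%:C *: S + (A1 - A2)).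
    rewrite rmorphB /= scalerBl; move: (_ *: S) (_ *: S) (_%:M) => P1 P2 P3.
    by apply/matrixP => i j; rewrite !mxE; ring.
  rewrite e in h3; apply: le_trans (pos_trace_add h1 hG h3) _.
  rewrite -addrA lerD2l; apply: le_trans (pos_trace_add h2 hD hG) _.
  rewrite ht [leRHS]addrC; apply: lerD; last exact: lexx.
  rewrite sum_ppart_id; last by move=> i; rewrite mulr_ge0.
  by rewrite -mulr_sumr mulrC.
Qed.

End Telescopic.

(** * From the matrices of the statement to MathComp matrices *)

Definition toC (z : Defs.C) : R[i] := Defs.Re z +i* Defs.Im z.

Lemma toC_inj : injective toC.
Proof. by case=> a b [c d] [-> ->]. Qed.

Lemma toCD x y : toC (Cadd x y) = toC x + toC y.
Proof. by case: x y => a b [c d]. Qed.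

Lemma toCM x y : toC (Cmul x y) = toC x * toC y.
Proof. by case: x y => a b [c d]. Qed.

Lemma toC_conj x : toC (Cconj x) = (toC x)^*.
Proof. by case: x. Qed.

Lemma toC_sum n f : toC (Csum n f) = \sum_(i < n) toC (f i).
Proof.
elim: n => [|n IH] /=; first by rewrite big_ord0.
by rewrite toCD IH big_ord_recr.
Qed.

Section Bridge.
Variable n : nat.
Implicit Types A B U : Mat.

Definition toM A : 'M[R[i]]_n := \matrix_(i, j) toC (A i j).

Definition ofM (X : 'M[R[i]]_n) : Mat := fun i j =>
  if (insub i, insub j) is (Some i', Some j') then
    mkC (complex.Re (X i' j')) (complex.Im (X i' j')) else Defs.C0.

Lemma ofMK : cancel ofM toM.
Proof.
move=> X; apply/matrixP => i j; rewrite mxE /ofM !valK.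
by case: (X i j).
Qed.

Lemma meqP A B : meq n A B <-> toM A = toM B.
Proof.
split=> [h|/matrixP h i j /ssrnat.ltP hi /ssrnat.ltP hj].
  by apply/matrixP => i j; rewrite !mxE h //; apply/ssrnat.ltP.
by have := h (Ordinal hi) (Ordinal hj); rewrite !mxE => /toC_inj.
Qed.

Lemma toM_mul A B : toM (Mmul n A B) = toM A *m toM B.
Proof.
apply/matrixP => i j; rewrite !mxE toC_sum; apply: eq_bigr => k _.
by rewrite toCM !mxE.
Qed.

Lemma toM_adj A : toM (Madj A) = (toM A)^t*.
Proof. by apply/matrixP => i j; rewrite !mxE toC_conj. Qed.

Lemma toM_add A B : toM (Madd A B) = toM A + toM B.
Proof. by apply/matrixP => i j; rewrite !mxE toCD. Qed.

Lemma toM_scale r A : toM (Mscale r A) = r%:C *: toM A.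
Proof. by apply/matrixP => i j; rewrite !mxE toCM. Qed.

Lemma toM_sub A B : toM (Msub A B) = toM A - toM B.
Proof.
rewrite toM_add toM_scale; congr (_ + _).
by rewrite (_ : IZR (Zneg xH) = - 1 :> R) // rmorphN1 scaleN1r.
Qed.

Lemma toM_diag (l : nat -> R) : toM (Mdiag l) = dg (fun i : 'I_n => l i).
Proof.
apply/matrixP => i j; rewrite dgE mxE /Mdiag.
case: (Nat.eqb_spec i j) => [/ord_inj -> | h]; first by rewrite eqxx.
by case: eqP => // e; case: h; rewrite e.
Qed.

Lemma toM_id : toM Mid = 1%:M.
Proof.
apply/matrixP => i j; rewrite !mxE /Mid.
case: (Nat.eqb_spec i j) => [/ord_inj -> | h]; first by rewrite eqxx.
by case: eqP => // e; case: h; rewrite e.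
Qed.

Lemma toC_trace A : toC (trace n A) = \tr (toM A).
Proof. by rewrite /trace toC_sum; apply: eq_bigr => i _; rewrite mxE. Qed.

Lemma Re_trace A : Defs.Re (trace n A) = rtr (toM A).
Proof. by rewrite /rtr -toC_trace. Qed.

Lemma hermP A : hermitian n A <-> (toM A)^t* = toM A.
Proof. by rewrite /hermitian meqP toM_adj; split. Qed.

Lemma eigdecompP A U l : eigdecomp n A U l <-> eigd (toM A) (toM U) (fun i => l i).
Proof.
by rewrite /eigdecomp /unitary !meqP !toM_mul !toM_adj toM_diag toM_id.
Qed.

(** The chosen pair is a decomposition as soon as one exists; [herm_eigd] supplies one, extended by
    0 outside the index range. *)
Lemma spec_eigd A : hermitian n A ->
  eigd (toM A) (toM (spec n A).1) (fun i => (spec n A).2 i).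
Proof.
move=> hA; apply/eigdecompP; apply: (epsilon_spec _ (fun p => eigdecomp n A p.1 p.2)).
have [U [l h]] := herm_eigd ((hermP A).1 hA).
exists (ofM U, fun i => if insub i is Some i' then l i' else 0) => /=.
apply/eigdecompP; rewrite ofMK; apply: eigd_ext h => i.
by rewrite valK.
Qed.

Lemma toM_fcalc f A : toM (fcalc n f A) =
  toM (spec n A).1 *m dg (fun i => f ((spec n A).2 i)) *m (toM (spec n A).1)^t*.
Proof. by rewrite /fcalc !toM_mul toM_adj toM_diag. Qed.

Lemma psd_eigd_ge0 A (U : 'M[R[i]]_n) l : psd n A -> eigd (toM A) U l ->
  forall i, 0 <= l i.
Proof.
move=> [_ hq] [hU hA] i.
(* The quadratic form at the i-th eigenvector is the i-th eigenvalue. *)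
pose v k := ofM U k i.
have -> : l i = Defs.Re (qform n A v).
  rewrite -[RHS]/(complex.Re (toC (qform n A v))).
  have -> : l i = complex.Re ((U^t* *m toM A *m U) i i).
    by rewrite hA !mulmxA hU mul1mx -mulmxA hU mulmx1 dgE eqxx.
  congr (complex.Re _); rewrite -mulmxA mxE /qform toC_sum; apply: eq_bigr => k _.
  rewrite toC_sum [(_ *m U) k i]mxE mulr_sumr; apply: eq_bigr => m _.
  have hv (k' : 'I_n) : toC (v k') = U k' i.
    by have /matrixP/(_ k' i) := ofMK U; rewrite mxE.
  by rewrite !toCM toC_conj !hv adjmxE mxE.
exact/RleP.
Qed.

(** The change of basis K intertwines [dg l] and [dg m], so a nonzero K i j forces m i = l j, and K
    intertwines the images under f as well. This frees [fcalc] from the chosen decomposition. *)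
Lemma eigd_fun_unique (A U W : 'M[R[i]]_n) l m (f : R -> R) :
  eigd A U l -> eigd A W m ->
  U *m dg (fun i => f (l i)) *m U^t* = W *m dg (fun i => f (m i)) *m W^t*.
Proof.
move=> [hU e1] [hW e2]; have hU' := unitary_adjr hU; have hW' := unitary_adjr hW.
pose K := W^t* *m U.
have hK : dg m *m K = K *m dg l.
  have : W^t* *m A *m U = W^t* *m A *m U by [].
  rewrite {1}e2 e1 !mulmxA hW mul1mx -!mulmxA hU mulmx1 /K !mulmxA; exact.
have eU : U = W *m K by rewrite /K mulmxA hW' mul1mx.
have KK : K *m K^t* = 1%:M.
  by rewrite /K adjM trmxCK mulmxA -(mulmxA _ U) hU' mulmx1 hW.
clearbody K.
have hfK : dg (fun i => f (m i)) *m K = K *m dg (fun i => f (l i)).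
  apply/matrixP => i j; have /matrixP/(_ i j) := hK.
  rewrite !mul_dgE /dg !mul_diag_mx ![(\matrix_(_, _) _) i j]mxE ![(\row__ _) _ _]mxE; move: (K i j) => z /eqP.
  rewrite [X in _ == X]mulrC -subr_eq0 -mulrBl mulf_eq0 => /orP[|/eqP ->].
    by rewrite subr_eq0 => /eqP/complexI ->; rewrite mulrC.
  by rewrite mulr0 mul0r.
rewrite eU adjM mulmxA -(mulmxA W K) -hfK -!mulmxA.
by rewrite (mulmxA K) KK mul1mx.
Qed.

End Bridge.

Lemma rtrB n (A B : 'M[R[i]]_n) : rtr (A - B) = rtr A - rtr B.
Proof. by apply/eqP; rewrite eq_sym subr_eq -rtrD subrK. Qed.

Lemma rtr_fun n (A U V : 'M[R[i]]_n) l g : eigd A U l ->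
  rtr (A *m (V *m dg g *m V^t*)) = \sum_j (\sum_i l i * ov U V i j) * g j.
Proof.
case=> _ ->; rewrite rtr_ov exchange_big; apply: eq_bigr => j _ /=.
by rewrite mulr_suml; apply: eq_bigr => i _; ring.
Qed.

(** The last hypothesis says that kernel vectors of the second matrix are orthogonal to the
    eigenvectors of the first with nonzero eigenvalue; f is the indicator of nonzero reals. *)
Lemma supp_mulmx n (U V : 'M[R[i]]_n) (l m : 'I_n -> R) (f : R -> R) :
  U^t* *m U = 1%:M -> V^t* *m V = 1%:M ->
  f 0 = 0 -> (forall x, x != 0 -> f x = 1) ->
  (forall i j, m j = 0 -> l i * ov U V i j = 0) ->
  (V *m dg (fun i => f (m i)) *m V^t*) *m (U *m dg (fun i => f (l i)) *m U^t*) =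
  U *m dg (fun i => f (l i)) *m U^t*.
Proof.
move=> hU hV f0 f1 h; have hV' := unitary_adjr hV.
pose K := U^t* *m V.
have eU : V *m K^t* = U by rewrite /K adjM trmxCK mulmxA hV' mul1mx.
have eK : V^t* *m U = K^t* by rewrite /K adjM trmxCK.
have {}h i j : m j = 0 -> l i * sqn (K i j) = 0 by exact: h.
clearbody K.
have hK : dg (fun i => f (m i)) *m K^t* *m dg (fun i => f (l i)) =
    K^t* *m dg (fun i => f (l i)).
  apply/matrixP => j i; rewrite !mul_dgE /dg mul_diag_mx [X in X * _]mxE [_ 0 j]mxE adjmxE.
  have [mj|mj] := eqVneq (m j) 0; last by rewrite f1 // mul1r.
  have [->|li] := eqVneq (l i) 0; first by rewrite f0 !mulr0.
  have /eqP := h i j mj; rewrite mulf_eq0 (negbTE li) sqn_eq0 => /eqP ->.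
  by rewrite (conjc0 R) mulr0.
transitivity (V *m (dg (fun i => f (m i)) *m (V^t* *m U) *m dg (fun i => f (l i))) *m U^t*).
  by rewrite !mulmxA.
by rewrite eK hK mulmxA eU.
Qed.

(** * The telescopic relative entropy through eigenvalues *)

Section Values.
Variables (n : nat) (a : R) (rho sigma : Mat).
Hypothesis a01 : 0 < a < 1.
Hypotheses (hrho : state n rho) (hsigma : state n sigma).

Let tau : Mat := Madd (Mscale a rho) (Mscale (1 - a) sigma).

Let toM_tau : toM n tau = a%:C *: toM n rho + (1 - a)%:C *: toM n sigma.
Proof. by rewrite toM_add !toM_scale. Qed.

Let a_gt0 : 0 < a. Proof. by case/andP: a01. Qed.
Let a_lt1 : a < 1. Proof. by case/andP: a01. Qed.

Lemma state_herm rho' : state n rho' -> hermitian n rho'.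
Proof. by case=> -[]. Qed.

Lemma state_rtr rho' : state n rho' -> rtr (toM n rho') = 1.
Proof. by case=> _ h; rewrite -Re_trace h. Qed.

Lemma tau_herm : hermitian n tau.
Proof.
apply/hermP; rewrite toM_tau.
by apply: hermD; apply: hermZ; apply/hermP; apply: state_herm.
Qed.

(** [tau] dominates a rho, which is read off on diagonal entries in the eigenbasis of [tau]. *)
Lemma tau_diag (U V : 'M[R[i]]_n) l m : eigd (toM n rho) U l -> eigd (toM n tau) V m ->
  forall j, 0 <= \sum_i l i * ov U V i j /\ a * (\sum_i l i * ov U V i j) <= m j.
Proof.
move=> hU hV j.
have hs := spec_eigd (state_herm hsigma).
have l0 := psd_eigd_ge0 hrho.1 hU; have s0 := psd_eigd_ge0 hsigma.1 hs.
have hV' := hV; rewrite toM_tau in hV'.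
split; first by apply: sumr_ge0 => i _; rewrite mulr_ge0 ?ov_ge0.
have a0 : 0 <= a by exact: ltW.
have a1 : 0 <= 1 - a by rewrite subr_ge0 ltW.
have := eigd_diag_ge0 (eigd_scale a hU) (eigd_scale (1 - a) hs) hV'
  (fun i => mulr_ge0 a0 (l0 i)) (fun i => mulr_ge0 a1 (s0 i)) j.
case/andP=> _; apply: le_trans; rewrite mulr_sumr.
by rewrite le_eqVlt; apply/orP; left; apply/eqP; apply: eq_bigr => i _; rewrite mulrA.
Qed.

(** Where [tau] has eigenvalue 0 the diagonal entry of rho vanishes by [tau_diag], and so does each
    of its nonnegative terms. Hence the entropy is finite. *)
Lemma tau_supp : supp_incl n rho tau.
Proof.
apply/(meqP n); rewrite toM_mul !toM_fcalc.
have hU := spec_eigd (state_herm hrho); have hV := spec_eigd tau_herm.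
have l0 := psd_eigd_ge0 hrho.1 hU; have hd := tau_diag hU hV.
move: (toM n (spec n tau).1) (spec n tau).2 hV hd => V m hV hd.
move: (toM n (spec n rho).1) (spec n rho).2 hU l0 hd => U l hU l0 hd.
refine (@supp_mulmx n U V (fun i => l i) (fun i => m i)
  (fun x => match Req_dec_T x (IZR Z0) with left _ => IZR Z0 | right _ => IZR (Zpos xH) end)
  hU.1 hV.1 _ _ _).
- by case: Req_dec_T.
- by move=> x /eqP hx; case: Req_dec_T.
move=> i j mj; have [h1 h2] := hd j; rewrite mj pmulr_rle0 // in h2.
have h3 : \sum_(k < n) l k * ov U V k j = 0 by apply/eqP; rewrite eq_le h1 h2.
by apply: (psumr_eq0P _ h3) => // i0 _; rewrite mulr_ge0 ?ov_ge0.
Qed.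

Lemma Sa_value (U V : 'M[R[i]]_n) l m :
  eigd (toM n rho) U l -> eigd (toM n tau) V m ->
  Sa n a rho sigma = Fin ((\sum_i l i * ln (l i) -
     \sum_j (\sum_i l i * ov U V i j) * ln (m j)) / (- ln a)).
Proof.
move=> hU hV; rewrite /Sa /relent -/tau.
case: excluded_middle_informative => [_|]; last by case; exact: tau_supp.
rewrite RealsE RoppE; congr (Fin (_ / _)).
rewrite Re_trace toM_mul toM_sub !toM_fcalc.
rewrite (eigd_fun_unique ln (spec_eigd (state_herm hrho)) hU).
rewrite (eigd_fun_unique ln (spec_eigd tau_herm) hV).
rewrite mulmxBr rtrB; congr (_ - _); last exact: rtr_fun.
by rewrite (eigd_funM _ hU.1 hU.2) (rtr_eigd (conj hU.1 erefl)).
Qed.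

End Values.

Lemma ln_lt0 (a : R) : 0 < a < 1 -> ln a < 0.
Proof. by case/andP=> a0 a1; apply: le_lt_trans (ln_le_subr1 a0) _; rewrite subr_lt0. Qed.

(** [tau] / a is rho + S with S = ((1 - a) / a) sigma, so the logarithm of [tau] splits off ln a,
    which accounts for the term 1. *)
Lemma Sa_Phi n (a : R) (rho sigma : Mat) : 0 < a < 1 -> state n rho -> state n sigma ->
  exists U l V y, [/\ eigd (toM n rho) U l, forall i, 0 <= l i,
    eigd (toM n rho + ((1 - a) / a)%:C *: toM n sigma) V y &
    Sa n a rho sigma = Fin (1 - Phi l (fun j => \sum_i l i * ov U V i j) y 0 / (- ln a))].
Proof.
move=> a01 hr hs; have /andP[a0 a1] := a01; have na0 : a != 0 by rewrite gt_eqF.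
have lna := ln_lt0 a01.
have hU := spec_eigd (state_herm hr); have l0 := psd_eigd_ge0 hr.1 hU.
have hV := spec_eigd (tau_herm a hr hs).
set tau := Madd (Mscale a rho) (Mscale (1 - a) sigma) in hV.
exists (toM n (spec n rho).1), (fun i => (spec n rho).2 i), (toM n (spec n tau).1),
  (fun i => a^-1 * (spec n tau).2 i).
have hd := tau_diag a01 hr hs hU hV; have hSa := Sa_value a01 hr hs hU hV.
have sl := rtr_eigd hU; rewrite (state_rtr hr) in sl.
have sp := ov_sum_total (fun i : 'I_n => (spec n rho).2 i) hU.1 hV.1.
have eY : a^-1%:C *: toM n tau = toM n rho + ((1 - a) / a)%:C *: toM n sigma.
  rewrite toM_add !toM_scale scalerDr !scalerA -!rmorphM.
  rewrite (mulVf na0) rmorph1 scale1r [a^-1 * _]mulrC; exact: erefl.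
have hY := eigd_scale a^-1 hV; rewrite eY in hY.
split; [exact: hU | exact: l0 | exact: hY |].
rewrite {}hSa; congr Fin.
move: (toM n (spec n tau).1) (spec n tau).2 hV hd sp => V m hV hd sp.
move: (toM n (spec n rho).1) (spec n rho).2 hU l0 hd sl sp => U l hU l0 hd sl sp.
pose p (j : 'I_n) := \sum_(i < n) l i * ov U V i j.
(* Splitting the logarithm requires m j > 0; [tau_diag] gives this wherever the weight p j is
   nonzero. *)
have e : \sum_(j < n) p j * ln (m j) = ln a + \sum_(j < n) p j * ln (a^-1 * m j).
  have -> : ln a = \sum_(j < n) p j * ln a by rewrite -mulr_suml sp -sl mul1r.
  rewrite -big_split; apply: eq_bigr => j _ /=.
  have [h1 h2] := hd j; rewrite -/(p j) in h1 h2 *.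
  move: h1; rewrite le_eqVlt => /orP[/eqP <-|h1]; first by rewrite !mul0r addr0.
  have m0 : 0 < m j by apply: lt_le_trans h2; rewrite mulr_gt0.
  by rewrite lnM_gt0 ?invr_gt0 // lnV_gt0 //; ring.
rewrite e /Phi.
under [\sum_(j < n) (_ + 0) * _]eq_bigr do rewrite !addr0.
under [\sum_(i < n) (l i + 0) * _]eq_bigr do rewrite !addr0.
by rewrite /p; field; rewrite lt_eqF.
Qed.

Lemma tdist_ppart n (rho1 rho2 : Mat) (Q : 'M[R[i]]_n) d : hermitian n (Msub rho1 rho2) ->
  eigd (toM n rho1 - toM n rho2) Q d -> tdist n rho1 rho2 = \sum_i ppart (d i).
Proof.
move=> hh hQ; have h := spec_eigd hh.
rewrite -toM_sub in hQ.
rewrite /tdist Re_trace /Mpos toM_scale toM_add /Mabs toM_fcalc.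
rewrite (eigd_fun_unique Rabs h hQ) rtrZ rtrD (rtr_eigd hQ) (rtr_eigd (conj hQ.1 erefl)).
rewrite -big_split mulr_sumr; apply: eq_bigr => i _ /=.
rewrite /ppart RabsE RdivE (_ : IZR 1 = 1 :> R) // (_ : IZR 2 = 2 :> R); last by rewrite -INRE.
rewrite /Num.max; case: ifP => h1.
  rewrite ltr0_norm //; lra.
rewrite ger0_norm; first lra.
by rewrite leNgt h1.
Qed.

Lemma Sa_variation n (rho1 rho2 sigma : Mat) (a t : R) : 0 < a < 1 ->
  state n rho1 -> state n rho2 -> state n sigma -> tdist n rho1 rho2 = t ->
  0 <= t <= 1 /\ exists x y, [/\ Sa n a rho1 sigma = Fin x, Sa n a rho2 sigma = Fin y &
    `|x - y| <= t * ln (1 + (1 - a) / a / t) / (- ln a)].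
Proof.
move=> a01 h1 h2 hs ht; have /andP[a0 a1] := a01; have lna := ln_lt0 a01.
have hA1 := (hermP n rho1).1 (state_herm h1); have hA2 := (hermP n rho2).1 (state_herm h2).
have [U1 [l1 [V1 [y1 [hU1 l10 hV1 e1]]]]] := Sa_Phi a01 h1 hs.
have [U2 [l2 [V2 [y2 [hU2 l20 hV2 e2]]]]] := Sa_Phi a01 h2 hs.
have hW := spec_eigd (state_herm hs); have s0 := psd_eigd_ge0 hs.1 hW.
have [Q [d hQ]] := herm_eigd (hermB hA1 hA2).
have hQ' : eigd (toM n rho2 - toM n rho1) Q (fun i => - d i).
  by have := eigdN hQ; rewrite opprB.
have sd : \sum_i d i = 0.
  by rewrite -(rtr_eigd hQ) rtrB (state_rtr h1) (state_rtr h2) subrr.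
have t1 : t = \sum_i ppart (d i).
  rewrite -ht; apply: tdist_ppart hQ; apply/hermP; rewrite toM_sub; exact: hermB.
(* The difference of the states has trace 0, so its positive and negative parts have equal trace;
   this serves the bound in the reverse order. *)
have t2 : t = \sum_i ppart (- d i).
  apply/eqP; rewrite t1 -subr_eq0 -sumrB -[X in _ == X]sd; apply/eqP; apply: eq_bigr => i _.
  by rewrite /ppart /Num.max; case: ifP; case: ifP; lra.
have c0 : 0 < (1 - a) / a by rewrite divr_gt0 ?subr_gt0.
have hS := eigd_scale ((1 - a) / a) hW.
have sc : \sum_(i < n) (1 - a) / a * (spec n sigma).2 i = (1 - a) / a.
  by rewrite -mulr_sumr -(rtr_eigd hW) (state_rtr hs) mulr1.
have cs0 (i : 'I_n) : 0 <= (1 - a) / a * (spec n sigma).2 i by rewrite mulr_ge0 // ltW.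
have csum : 0 < \sum_(i < n) (1 - a) / a * (spec n sigma).2 i by rewrite sc.
have b1 := telescopic_variation hU1 hU2 hS hV1 hV2 hQ l10 l20 cs0 csum t1.
have b2 := telescopic_variation hU2 hU1 hS hV2 hV1 hQ' l20 l10 cs0 csum t2.
rewrite sc in b1 b2; split.
  rewrite t1; apply/andP; split; first by apply: sumr_ge0 => i _; rewrite le_max lexx orbT.
  have := pos_trace_add hU1 (eigdN hU2) hQ.
  have z : \sum_i ppart (- l2 i) = 0.
    by apply: (@sum_ppart0 _ (fun i => - l2 i)) => i; rewrite oppr_le0.
  rewrite (sum_ppart_id l10) z.
  by rewrite addr0 -(rtr_eigd hU1) (state_rtr h1).
exists (1 - Phi l1 (fun j => \sum_i l1 i * ov U1 V1 i j) y1 0 / - ln a).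
exists (1 - Phi l2 (fun j => \sum_i l2 i * ov U2 V2 i j) y2 0 / - ln a).
split=> //.
have L0 : 0 < - ln a by rewrite oppr_gt0.
move: (Phi l1 _ _ _) (Phi l2 _ _ _) b1 b2 => P1 P2 b1 b2.
have -> : 1 - P1 / - ln a - (1 - P2 / - ln a) = (P2 - P1) / - ln a by ring.
rewrite normrM [`|_^-1|]gtr0_norm ?invr_gt0 // ler_pM2r ?invr_gt0 //.
by rewrite ler_norml b2 andbT lerNl opprB.
Qed.

(** * Orthogonal states *)

(** The trace is a sum of nonnegative terms, so each vanishes, and with it each entry of the product
    between the two eigenbases. *)
Lemma eigd_orthogonal n (A B U W : 'M[R[i]]_n) a b :
  eigd A U a -> eigd B W b -> (forall i, 0 <= a i) -> (forall i, 0 <= b i) ->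
  rtr (A *m B) = 0 -> A *m B = 0.
Proof.
move=> hA hB a0 b0; rewrite {1}hA.2 {1}hB.2 rtr_ov => h.
have t0 i j : 0 <= a i * b j * ov U W i j by rewrite !mulr_ge0 ?ov_ge0.
have hz i j : a i * b j * ov U W i j = 0.
  have h1 : \sum_j a i * b j * ov U W i j = 0.
    by apply: (psumr_eq0P _ h) => // k _; apply: sumr_ge0.
  by apply: (psumr_eq0P _ h1).
have hK : dg a *m (U^t* *m W) *m dg b = 0.
  apply/matrixP => i j; rewrite mul_dgE /dg mul_diag_mx [LHS]mulrC mxE [(\row__ _) _ _]mxE.
  rewrite [RHS]mxE; have /eqP := hz i j; rewrite !mulf_eq0 sqn_eq0.
  by case/orP=> [/orP[]|] /eqP ->; rewrite ?mul0r ?mulr0 ?rmorph0 ?mul0r ?mulr0.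
have -> : A *m B = U *m (dg a *m (U^t* *m W) *m dg b) *m W^t*.
  by rewrite hA.2 hB.2 !mulmxA.
by rewrite hK mulmx0 mul0mx.
Qed.

(* [A] and [B] are the positive and negative parts of [A - B]. *)
Lemma eigd_orthogonal_joint n (A B U W : 'M[R[i]]_n) a b :
  eigd A U a -> eigd B W b -> (forall i, 0 <= a i) -> (forall i, 0 <= b i) ->
  A *m B = 0 ->
  exists Q h, eigd A Q (fun i => ppart (h i)) /\ eigd B Q (fun i => ppart (- h i)).
Proof.
move=> hA hB a0 b0 hAB; have hAh := eigd_herm hA; have hBh := eigd_herm hB.
have hBA : B *m A = 0 by rewrite -hAh -hBh -adjM hAB trmx0 map_mx0.
have [Q [h hQ]] := herm_eigd (hermB hAh hBh); exists Q, h.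
have QQ := hQ.1; have QQ' := unitary_adjr QQ.
(* For N the matrix of X in the basis Q, XY = 0 gives N^2 = N [dg g]. Its i-th diagonal entry
   equates the squared norm of row i of N with N_ii g_i, which is at most 0. *)
have key (X Y Z : 'M[R[i]]_n) x g : eigd X Z x -> (forall i, 0 <= x i) ->
    X *m Y = 0 -> eigd (X - Y) Q g -> forall i, g i <= 0 -> forall j, (Q^t* *m X *m Q) i j = 0.
  move=> hX x0 hXY hg i gi j; have Xh := eigd_herm hX.
  pose N := Q^t* *m X *m Q.
  have Nh k : N k i = (N i k)^*.
    by rewrite -(adjmxE N k i) /N !adjM trmxCK Xh !mulmxA.
  have Nii : exists2 r : R, 0 <= r & N i i = r%:C.
    exists (\sum_k x k * sqn ((Z^t* *m Q) k i)).
      by apply: sumr_ge0 => k _; rewrite mulr_ge0 ?sqn_ge0.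
    have -> : N = (Z^t* *m Q)^t* *m dg x *m (Z^t* *m Q).
      by rewrite /N hX.2 adjM trmxCK !mulmxA.
    rewrite mxE rmorph_sum; apply: eq_bigr => k _.
    by rewrite mul_dgE adjmxE rmorphM /= sqnE; ring.
  have NN : N *m N = N *m dg g.
    have -> : dg g = Q^t* *m (X - Y) *m Q.
      by rewrite hg.2 !mulmxA QQ mul1mx -mulmxA QQ mulmx1.
    transitivity (Q^t* *m (X *m (Q *m Q^t*) *m X) *m Q); first by rewrite /N !mulmxA.
    transitivity (Q^t* *m (X *m (Q *m Q^t*) *m (X - Y)) *m Q); last by rewrite /N !mulmxA.
    by rewrite QQ' mulmx1 mulmxBr hXY subr0.
  rewrite -/N; clearbody N.
  have [r r0 hr] := Nii.
  have eq : \sum_k sqn (N i k) = r * g i.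
    apply: (@complexI R); have /matrixP/(_ i i) := NN.
    rewrite mul_dgE hr -rmorphM => <-; rewrite mxE rmorph_sum /=.
    by apply: eq_bigr => k _; rewrite sqnE Nh.
  have s0 : \sum_k sqn (N i k) = 0.
    apply/eqP; rewrite eq_le; apply/andP; split; last by apply: sumr_ge0 => k _; exact: sqn_ge0.
    by rewrite eq mulr_ge0_le0.
  have : sqn (N i j) = 0 by apply: (psumr_eq0P _ s0) => // k _; exact: sqn_ge0.
  by move/eqP; rewrite sqn_eq0 => /eqP.
have keyA := key A B U a h hA a0 hAB hQ.
have hQ' : eigd (B - A) Q (fun i => - h i) by have := eigdN hQ; rewrite opprB.
have keyB := key B A W b _ hB b0 hBA hQ'.
have sub i j : (Q^t* *m A *m Q) i j - (Q^t* *m B *m Q) i j = (h i)%:C *+ (i == j).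
  have -> : (h i)%:C *+ (i == j) = (Q^t* *m (A - B) *m Q) i j.
    by rewrite hQ.2 !mulmxA QQ mul1mx -mulmxA QQ mulmx1 dgE.
  rewrite mulmxBr mulmxBl; move: (Q^t* *m A *m Q) (Q^t* *m B *m Q) => P1 P2.
  by rewrite !mxE.
have fin (X : 'M[R[i]]_n) x : Q^t* *m X *m Q = dg x -> eigd X Q x.
  move=> e; split=> //; rewrite -e !mulmxA QQ' mul1mx -mulmxA QQ' mulmx1; exact: erefl.
split; apply: fin; apply/matrixP => i j; rewrite dgE; have := sub i j.
  case: (leP (h i) 0) => hi.
    by rewrite keyA // /ppart max_r // mul0rn.
  by rewrite keyB ?oppr_le0 1?ltW // subr0 => ->; rewrite /ppart max_l // ltW.
case: (leP (h i) 0) => hi.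
  rewrite keyA // sub0r => e; rewrite -[LHS]opprK e /ppart max_l ?oppr_ge0 //.
  by rewrite rmorphN mulNrn.
by rewrite keyB ?oppr_le0 1?ltW // /ppart max_r ?oppr_le0 1?ltW // mul0rn.
Qed.

Lemma Sa_joint n (a : R) (rho sigma : Mat) (Q : 'M[R[i]]_n) p q : 0 < a < 1 ->
  state n rho -> state n sigma -> eigd (toM n rho) Q p -> eigd (toM n sigma) Q q ->
  Sa n a rho sigma = Fin ((\sum_i p i * (ln (p i) - ln (a * p i + (1 - a) * q i))) / (- ln a)).
Proof.
move=> a01 hr hs hp hq.
have hV : eigd (toM n (Madd (Mscale a rho) (Mscale (1 - a) sigma))) Q
    (fun i => a * p i + (1 - a) * q i).
  rewrite toM_add !toM_scale; split; first exact: hp.1.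
  by rewrite -dgD mulmxDr mulmxDl -(eigd_scale a hp).2 -(eigd_scale (1 - a) hq).2.
rewrite (Sa_value a01 hr hs hp hV); congr (Fin (_ / _)).
rewrite -sumrB; apply: eq_bigr => i _; rewrite mulrBr; congr (_ - _ * _).
rewrite (bigD1 i) //= ov_self ?hp.1 // eqxx mulr1 big1 ?addr0 // => j /negbTE hj.
by rewrite ov_self ?hp.1 // hj mulr0.
Qed.

Lemma Sa_scE (a b c : R) :
  Sa_sc a b c = b * (ln b - ln (a * b + (1 - a) * c)) / (- ln a).
Proof. by rewrite /Sa_sc RdivE. Qed.

Lemma Sa_sc_r0 (a b : R) : 0 < a < 1 -> 0 <= b -> Sa_sc a b 0 = b.
Proof.
move=> a01 b0; have lna := ln_lt0 a01; case/andP: a01 => a0 _.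
rewrite Sa_scE mulr0 addr0; move: b0; rewrite le_eqVlt => /orP[/eqP <-|b0].
  by rewrite !mul0r.
by rewrite lnM_gt0 //; field; rewrite lt_eqF.
Qed.

Lemma subr_Sa_sc_r1 (a t : R) : 0 < a < 1 -> 0 <= t ->
  t - Sa_sc a t 1 = t * ln (1 + (1 - a) / a / t) / (- ln a).
Proof.
move=> a01 t0; have lna := ln_lt0 a01; case/andP: a01 => a0 a1.
(* At t = 0 both sides are 0, whatever the default value of the quotient by t. *)
rewrite Sa_scE mulr1; move: t0; rewrite le_eqVlt => /orP[/eqP <-|t0].
  by rewrite !mul0r subrr.
have h : 0 < a * t + (1 - a) by rewrite addr_gt0 ?mulr_gt0 ?subr_gt0.
have -> : 1 + (1 - a) / a / t = (a * t + (1 - a)) * (a^-1 * t^-1).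
  by field; rewrite !gt_eqF.
rewrite lnM_gt0 ?mulr_gt0 ?invr_gt0 // lnM_gt0 ?invr_gt0 // !lnV_gt0 //.
by field; rewrite lt_eqF.
Qed.

Lemma Sa_orthogonal n (a t : R) (rho1 rho2 sigma : Mat) : 0 < a < 1 -> 0 <= t <= 1 ->
  state n rho1 -> state n rho2 -> state n sigma ->
  trace n (Mmul n rho1 sigma) = Defs.C0 ->
  meq n rho2 (Madd (Mscale t sigma) (Mscale (1 - t) rho1)) ->
  Sa n a rho1 sigma = Fin 1 /\ Sa n a rho2 sigma = Fin (1 - t + Sa_sc a t 1).
Proof.
move=> a01 /andP[t0 t1] h1 h2 hs htr /(meqP n).
rewrite toM_add !toM_scale => e2.
have lna := ln_lt0 a01; have [a0 a1] := andP a01.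
have hU := spec_eigd (state_herm h1); have hW := spec_eigd (state_herm hs).
have l0 := psd_eigd_ge0 h1.1 hU; have s0 := psd_eigd_ge0 hs.1 hW.
have r0 : rtr (toM n rho1 *m toM n sigma) = 0 by rewrite -toM_mul -Re_trace htr.
have [Q [h [hp hq]]] := eigd_orthogonal_joint hU hW l0 s0 (eigd_orthogonal hU hW l0 s0 r0).
set p := fun i => ppart (h i) in hp; set q := fun i => ppart (- h i) in hq.
have hr : eigd (toM n rho2) Q (fun i => t * q i + (1 - t) * p i).
  rewrite e2; split; first exact: hp.1.
  by rewrite -dgD mulmxDr mulmxDl -(eigd_scale t hq).2 -(eigd_scale (1 - t) hp).2.
have sp : \sum_i p i = 1 by rewrite -(rtr_eigd hp) (state_rtr h1).
have sq : \sum_i q i = 1 by rewrite -(rtr_eigd hq) (state_rtr hs).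
(* In the joint eigenbasis p and q have disjoint supports, so each index carries a scalar
   computation. *)
have pq i : (p i = 0 /\ 0 <= q i) \/ (0 < p i /\ q i = 0).
  rewrite /p /q /ppart /Num.max.
  case: ifP => h1'; case: ifP => h2'; [left|left|right|left]; lra.
rewrite (Sa_joint a01 h1 hs hp hq) (Sa_joint a01 h2 hs hr hq); split; congr Fin.
  rewrite (eq_bigr (fun i => p i * - ln a)); last first.
    move=> i _; case: (pq i) => [[-> _]|[pi ->]]; first by rewrite !mul0r.
    by rewrite mulr0 addr0 lnM_gt0 //; ring.
  by rewrite -mulr_suml sp mul1r divff // lt0r_neq0 // oppr_gt0.
rewrite Sa_scE mulr1.
rewrite (eq_bigr (fun i => (1 - t) * p i * - ln a + q i * (t * (ln t - ln (a * t + (1 - a)))))).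
  by rewrite big_split /= -!mulr_suml -mulr_sumr sp sq; field; rewrite lt_eqF.
move=> i _; case: (pq i) => [[-> qi]|[pi ->]].
  rewrite !mulr0 mul0r addr0 add0r.
  move: t0; rewrite le_eqVlt => /orP[/eqP <-|t0]; first by rewrite !mul0r mulr0.
  move: qi; rewrite le_eqVlt => /orP[/eqP <-|qi]; first by rewrite mulr0 !mul0r.
  (* On the support of q the eigenvalue q i factors out of both logarithms and cancels, leaving the
     scalar entropy of t against 1. *)
  have -> : a * (t * q i) + (1 - a) * q i = (a * t + (1 - a)) * q i by ring.
  by rewrite !lnM_gt0 //; [ring | rewrite addr_gt0 ?mulr_gt0 ?subr_gt0].
rewrite !mulr0 mul0r addr0 add0r addr0.
move: t1; rewrite le_eqVlt => /orP[/eqP ->|t1]; first by rewrite subrr !mul0r.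
have pt : 0 < (1 - t) * p i by rewrite mulr_gt0 ?subr_gt0.
by rewrite lnM_gt0 //; ring.
Qed.

Local Close Scope ring_scope.
Open Scope R_scope.

Theorem theorem2 (n : nat) (a : R) (rho1 rho2 sigma : Mat) (t : R) :
  0 < a < 1 ->
  state n rho1 -> state n rho2 -> state n sigma ->
  tdist n rho1 rho2 = t ->
  (match Sa n a rho1 sigma, Sa n a rho2 sigma with
   | Fin x, Fin y => Rabs (x - y) <= 1 - Sa_sc a (1 - t) 0 - Sa_sc a t 1
   | _, _ => False
   end)
  /\ 1 - Sa_sc a (1 - t) 0 - Sa_sc a t 1 = t - Sa_sc a t 1
  /\ (trace n (Mmul n rho1 sigma) = C0 ->
      meq n rho2 (Madd (Mscale t sigma) (Mscale (1 - t) rho1)) ->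
      match Sa n a rho1 sigma, Sa n a rho2 sigma with
      | Fin x, Fin y => Rabs (x - y) = t - Sa_sc a t 1
      | _, _ => False
      end).
Proof.
move=> [/RltP a0 /RltP a1] h1 h2 hs ht.
have a01 : (0 < a < 1)%O by apply/andP.
have [t01 [x [y [ex ey hxy]]]] := Sa_variation a01 h1 h2 hs ht.
have /andP[t0 t1] := t01.
have hb := subr_Sa_sc_r1 a01 t0; rewrite -hb in hxy.
have e : 1 - Sa_sc a (1 - t) 0 - Sa_sc a t 1 = t - Sa_sc a t 1.
  have -> : Sa_sc a (1 - t) 0 = 1 - t by apply: Sa_sc_r0; rewrite // subr_ge0.
  by rewrite !RminusE; ring.
split; last split=> //.
  by rewrite ex ey e RabsE; apply/RleP.
move=> htr hm; have [e1 e2] := Sa_orthogonal a01 t01 h1 h2 hs htr hm.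
move: ex ey hxy; rewrite e1 e2 => -[<-] [<-] hxy.
rewrite RabsE !RminusE.
have -> : (1 - (1 - t + Sa_sc a t 1) = t - Sa_sc a t 1)%R by ring.
(* The right-hand side is nonnegative because it bounds an absolute value in the general
   inequality. *)
by rewrite ger0_norm // (le_trans _ hxy).
Qed.
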